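(* Assume that $\det(\mathcal B_\tau)\neq 0$, and that there exist constants $L\ge 0$, $M\ge 1$, $\omega>0$, along with a closed convex domain $D'\subset D$, such that: (i) $\|g'(\xi)\|\le L$ and $\|e^{tA}\|\le M e^{\omega|t|}$ for all $\xi\in D$, $t\in[-\tau,\tau]$; (ii) $\mathcal F(x)\in X_{D'}$ for each $x\in X_{D'}$; (iii) $\displaystyle \frac{L M (e^{\omega\tau}-1)\left(1+M\,\|\mathcal B_\tau^{-1}\|\, e^{\omega\tau}\,\|\mathcal B\|_0\right)}{\omega}<1.$ Then, for any $x^{(0)}\in X_{D'}$, the sequence $x^{(k)}=\mathcal F(x^{(k-1)})$, $k=1,2,\dots$, converges to the limit $x^*\in X_{D'}$ as $k\to\infty$. This limit function $x^*(t)$ is the unique solution of the boundary value problem $$\dot x(t)=Ax(t)+g(x(t))+u(t),\quad x\in D\subset\mathbb R^n,\ t\in[0,\tau],\qquad \mathcal B(x)=\beta .$$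
   Context: Let $\tau>0$, let $D\subset\mathbb R^n$ be a domain containing the origin, $A$ a constant $n\times n$ matrix, $g\in C^1(D;\mathbb R^n)$ with Jacobian matrix $g'(\xi)=\partial g(\xi)/\partial\xi$, and $u\in L^\infty([0,\tau];\mathbb R^n)$ an arbitrary control function. $\|\cdot\|$ on $\mathbb R^n$ is the Euclidean norm, and on matrices the induced 2-norm. $X=C([0,\tau];\mathbb R^n)$ is the Banach space of continuous functions with the norm $\|x\|=\sup_{t\in[0,\tau]}\|x(t)\|$; $X_D=C([0,\tau];D)$ and $X_{D'}=C([0,\tau];D')$ are the subsets of functions with values in $D$, respectively $D'$. $\mathcal B:X\to\mathbb R^n$ is a given bounded linear operator (vector functional) and $\beta\in\mathbb R^n$ a given vector. When $x(t)$ is an explicit expression in $t$, $\mathcal B(x(t))$ denotes the value of $\mathcal B$ at the function $t\mapsto x(t)$. $\mathcal B_\tau$ is the constant $n\times n$ matrix defined by $\mathcal B_\tau\xi_0=\mathcal B(e^{tA}\xi_0)$ for all $\xi_0\in\mathbb R^n$. With $\mathring X=\{x\in X : x(0)=0\}$, set $\|\mathcal B\|_0=\sup\{\|\mathcal B(x)\| : x\in\mathring X,\ \|x\|\le 1\}$. When $\mathcal B_\tau$ is nonsingular, the operator $\mathcal F:X_D\to X$ is defined by $$\mathcal F(x)(t)=e^{tA}c(x)+\int_0^t e^{(t-s)A}[g(x(s))+u(s)]\,ds,$$ $$c(x)=\mathcal B_\tau^{-1}\beta-\mathcal B_\tau^{-1}\mathcal B\left(\int_0^t e^{(t-s)A}[g(x(s))+u(s)]\,ds\right).$$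 Solutions of the differential equation are understood in the sense of Carathéodory, i.e. as solutions of the integral equation $x(t)=x(0)+\int_0^t[Ax(s)+g(x(s))+u(s)]\,ds$, $t\in[0,\tau]$.
   Formalization: Uniqueness of the solution x* is asserted among solutions with values in D', and among all solutions with values in D when D is convex; for a nonconvex domain D the bound on g' gives no global Lipschitz constant and uniqueness in D can fail. *)

(* Defs.v *)
From HB Require Import structures.
From mathcomp Require Import all_boot all_order all_algebra.
From mathcomp Require Import all_classical all_reals all_analysis.
Set Implicit Arguments.
Unset Strict Implicit.
Unset Printing Implicit Defensive.
Import Order.TTheory GRing.Theory Num.Theory.
Import numFieldTopology.Exports numFieldNormedType.Exports.
Local Open Scope classical_set_scope.
Local Open Scope ring_scope.

(* The library norm on matrices is the max norm, hence the two definitions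
   below; the topology it induces is the usual one. *)
Definition enorm (R : realType) (n : nat) (v : 'cV[R]_n) : R :=
  Num.sqrt (\sum_i v i 0 ^+ 2).

Definition mxnorm2 (R : realType) (n : nat) (A : 'M[R]_n) : R :=
  sup [set enorm (A *m v) | v in [set v : 'cV[R]_n | enorm v <= 1]].

Definition expmx (R : realType) (n : nat) (A : 'M[R]_n) : 'M[R]_n :=
  limn (series (fun k : nat => (k`!%:R)^-1 *: A ^+ k)).

Definition jacobian_mx (R : realType) (n : nat)
    (g : 'cV[R]_n -> 'cV[R]_n) (xi : 'cV[R]_n) : 'M[R]_n :=
  \matrix_(i, j) 'D_(delta_mx j 0) (fun y => g y i 0) xi.

(* Meaningful for open D only. *)
Definition C1_on (R : realType) (n : nat) (D : set 'cV[R]_n)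
    (g : 'cV[R]_n -> 'cV[R]_n) : Prop :=
  forall xi, D xi ->
    differentiable g xi /\ {for xi, continuous (jacobian_mx g)}.

Definition is_domain (R : realType) (n : nat) (D : set 'cV[R]_n) : Prop :=
  [/\ open D, connected D & D !=set0].

(* An element of C([0, tau]; D) is represented by any function on R whose
   restriction to [0, tau] is continuous and takes its values in D; values
   outside [0, tau] are irrelevant. *)
Definition CX (R : realType) (n : nat) (tau : R) (D : set 'cV[R]_n)
    (x : R -> 'cV[R]_n) : Prop :=
  {within `[0, tau], continuous x} /\ (forall t, t \in `[0, tau] -> D (x t)).

Definition supnorm (R : realType) (n : nat) (tau : R) (x : R -> 'cV[R]_n) : R :=
  sup [set enorm (x t) | t in `[0, tau]].

(* L^oo([0, tau]; R^n), its elements being given by Borel representatives. *)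
Definition in_Linfty (R : realType) (n : nat) (tau : R)
    (u : R -> 'cV[R]_n) : Prop :=
  (forall i, measurable_fun `[0, tau] (fun t => u t i 0)) /\
  (exists C : R, {ae (@lebesgue_measure R),
     forall t, t \in `[0, tau] -> enorm (u t) <= C}).

Definition vint (R : realType) (n : nat) (a b : R) (f : R -> 'cV[R]_n)
    : 'cV[R]_n :=
  \col_i \int[@lebesgue_measure R]_(s in `[a, b]) (f s i 0).

(* Since functions that agree on [0, tau] differ by a function of supnorm 0,
   the last condition also makes B x depend only on x restricted to
   [0, tau]. *)
Definition bounded_linear_functional (R : realType) (n : nat) (tau : R)
    (B : (R -> 'cV[R]_n) -> 'cV[R]_n) : Prop :=
  (forall (a : R) (x y : R -> 'cV[R]_n), CX tau setT x -> CX tau setT y ->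
     B (fun t => a *: x t + y t) = a *: B x + B y) /\
  (exists C : R, forall x : R -> 'cV[R]_n, CX tau setT x ->
     enorm (B x) <= C * supnorm tau x).

Definition opnorm0 (R : realType) (n : nat) (tau : R)
    (B : (R -> 'cV[R]_n) -> 'cV[R]_n) : R :=
  sup [set enorm (B x) | x in
    [set x | [/\ CX tau setT x, x 0 = 0 & supnorm tau x <= 1]]].

(* The matrix of the linear map xi |-> B (t |-> e^{tA} xi): its j-th column is
   the value of that map at the j-th vector of the canonical basis. *)
Definition Btau (R : realType) (n : nat) (A : 'M[R]_n)
    (B : (R -> 'cV[R]_n) -> 'cV[R]_n) : 'M[R]_n :=
  \matrix_(i, j) B (fun t => expmx (t *: A) *m delta_mx j 0) i 0.

Definition duhamel (R : realType) (n : nat) (A : 'M[R]_n)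
    (g : 'cV[R]_n -> 'cV[R]_n) (u x : R -> 'cV[R]_n) : R -> 'cV[R]_n :=
  fun t => vint 0 t (fun s => expmx ((t - s) *: A) *m (g (x s) + u s)).

Definition picard_const (R : realType) (n : nat) (A : 'M[R]_n)
    (g : 'cV[R]_n -> 'cV[R]_n) (u : R -> 'cV[R]_n)
    (B : (R -> 'cV[R]_n) -> 'cV[R]_n) (beta : 'cV[R]_n)
    (x : R -> 'cV[R]_n) : 'cV[R]_n :=
  invmx (Btau A B) *m beta - invmx (Btau A B) *m B (duhamel A g u x).

Definition picard_op (R : realType) (n : nat) (A : 'M[R]_n)
    (g : 'cV[R]_n -> 'cV[R]_n) (u : R -> 'cV[R]_n)
    (B : (R -> 'cV[R]_n) -> 'cV[R]_n) (beta : 'cV[R]_n)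
    (x : R -> 'cV[R]_n) : R -> 'cV[R]_n :=
  fun t => expmx (t *: A) *m picard_const A g u B beta x + duhamel A g u x t.

(* Caratheodory solution, with values in D, of
   x' = A x + g(x) + u on [0, tau], B x = beta. *)
Definition bvp_solution (R : realType) (n : nat) (tau : R) (D : set 'cV[R]_n)
    (A : 'M[R]_n) (g : 'cV[R]_n -> 'cV[R]_n) (u : R -> 'cV[R]_n)
    (B : (R -> 'cV[R]_n) -> 'cV[R]_n) (beta : 'cV[R]_n)
    (x : R -> 'cV[R]_n) : Prop :=
  [/\ CX tau D x,
      forall t, t \in `[0, tau] ->
        x t = x 0 + vint 0 t (fun s => A *m x s + g (x s) + u s)
    & B x = beta].

(* Main.v *)
Require Import Defs.
From HB Require Import structures.
From mathcomp Require Import all_boot all_order all_algebra.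
From mathcomp Require Import all_classical all_reals all_analysis.
From mathcomp Require Import measurable_realfun.
From mathcomp Require Import ring lra.
Set Implicit Arguments.
Unset Strict Implicit.
Unset Printing Implicit Defensive.
Import Order.TTheory GRing.Theory Num.Theory.
Import numFieldTopology.Exports numFieldNormedType.Exports.
Local Open Scope classical_set_scope.
Local Open Scope ring_scope.

(** The operator F turns the boundary value problem into a fixed-point problem,
    and the smallness condition makes F a contraction for the sup norm.

    Fixed points are solutions. For an essentially bounded forcing h, a curve
    solves y(t) = y(0) + int_0^t (A y + h) if and only if it satisfies the
    Duhamel formula y(t) = e^{tA} y(0) + int_0^t e^{(t-s)A} h(s) ds
    ([duhamel_solution], [solution_duhamel]). As h is only measurable, neither
    side may be differentiated pointwise, and an exchange of integrals would be
    needed for a direct computation. Instead, both one-step maps, from time s to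
    time t, agree up to an error O((t-s)^2) ([step_gap]), and a curve all of
    whose increments are O((t-s)^2) is constant
    ([eq_of_quadratic_increments]); applied to the difference of the two sides
    of the formula to be proved (transported back by e^{-tA} in one of the two
    directions) this gives both implications. The boundary condition B y = beta
    then says exactly that y(0) = c(y), because B(e^{tA} v) = B_tau v and B_tau
    is invertible ([picard_fixed_iff_solution]).

    Contraction. On a convex part of D the bound on the Jacobian makes g
    L-Lipschitz for the Euclidean norm ([mean_value_le]). So two curves at
    distance d have Duhamel integrals at distance at most
    int_0^t M e^{omega (t-s)} L d ds <= kappa d with
    kappa = L M (e^{omega tau} - 1) / omega. These integrals vanish at time 0,
    which is why only the norm of B on curves vanishing at 0 enters the bound on
    c(x) - c(y). The two contributions add up to the constant q that is assumed
    to be less than 1 ([picard_contraction]).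

    Limit. The iterates are Cauchy at each time with a geometric rate that is
    uniform in time, so they have a pointwise limit that is also a uniform limit;
    it is continuous, takes its values in the closed set D', and is fixed by F
    ([picard_fixed_exists]). Uniqueness is the usual contraction argument, run
    in D' or, when D is convex, in D itself ([picard_fixed_unique]). *)

(** * The Euclidean norm and the induced matrix norm *)
Section EuclideanNorm.
Context {R : realType} {n : nat}.
Implicit Types (v w : 'cV[R]_n) (A : 'M[R]_n).

Definition edot v w : R := \sum_i v i 0 * w i 0.

Lemma enorm_ge0 v : 0 <= enorm v.
Proof. exact: sqrtr_ge0. Qed.

Lemma enorm_sqr v : enorm v ^+ 2 = edot v v.
Proof.
rewrite sqr_sqrtr; last by apply: sumr_ge0 => i _; exact: sqr_ge0.
by apply: eq_bigr => i _; rewrite expr2.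
Qed.

Lemma coord_le_enorm v i : `|v i 0| <= enorm v.
Proof.
rewrite -sqrtr_sqr ler_wsqrtr// (bigD1 i)//= lerDl.
by apply: sumr_ge0 => j _; exact: sqr_ge0.
Qed.

Lemma enorm0_eq0 v : enorm v = 0 -> v = 0.
Proof.
move=> v0; apply/matrixP => i j; rewrite ord1 mxE; apply/eqP.
by rewrite -normr_eq0 eq_le normr_ge0 -v0 coord_le_enorm.
Qed.

Lemma enorm0 : enorm (0 : 'cV[R]_n) = 0.
Proof. by rewrite /enorm big1 ?sqrtr0// => i _; rewrite mxE expr0n. Qed.

Lemma enormZ a v : enorm (a *: v) = `|a| * enorm v.
Proof.
rewrite /enorm -sqrtr_sqr -sqrtrM ?sqr_ge0// mulr_sumr.
by congr Num.sqrt; apply: eq_bigr => i _; rewrite mxE exprMn.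
Qed.

Lemma enormN v : enorm (- v) = enorm v.
Proof. by rewrite -scaleN1r enormZ normrN1 mul1r. Qed.

Lemma enorm_distC v w : enorm (v - w) = enorm (w - v).
Proof. by rewrite -enormN opprB. Qed.

Lemma edotC v w : edot v w = edot w v.
Proof. by apply: eq_bigr => i _; rewrite mulrC. Qed.

Lemma edotDr v w1 w2 : edot v (w1 + w2) = edot v w1 + edot v w2.
Proof. by rewrite -big_split/=; apply: eq_bigr => i _; rewrite mxE mulrDr. Qed.

Lemma edotNr v w : edot v (- w) = - edot v w.
Proof. by rewrite -sumrN; apply: eq_bigr => i _; rewrite mxE mulrN. Qed.

(** Cauchy-Schwarz: with a and b the norms of v and w, the difference
    a b (a b - <v, w>) is half the squared norm of b v - a w. *)
Lemma edot_le v w : edot v w <= enorm v * enorm w.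
Proof.
have [v0|v0] := eqVneq (enorm v) 0.
  rewrite v0 mul0r (enorm0_eq0 v0) /edot big1// => i _.
  by rewrite mxE mul0r.
have [w0|w0] := eqVneq (enorm w) 0.
  rewrite w0 mulr0 (enorm0_eq0 w0) /edot big1// => i _.
  by rewrite mxE mulr0.
have ab0 : 0 < enorm v * enorm w.
  by rewrite mulr_gt0// lt_neqAle eq_sym enorm_ge0 ?v0 ?w0.
rewrite -(ler_pM2l ab0) -subr_ge0.
have -> : enorm v * enorm w * (enorm v * enorm w)
    - enorm v * enorm w * edot v w =
    2^-1 * \sum_i (enorm w * v i 0 - enorm v * w i 0) ^+ 2.
  have -> : \sum_i (enorm w * v i 0 - enorm v * w i 0) ^+ 2 =
      enorm w ^+ 2 * edot v v - 2 * (enorm v * enorm w) * edot v w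
      + enorm v ^+ 2 * edot w w.
    rewrite /edot !mulr_sumr -sumrB -big_split/=.
    by apply: eq_bigr => i _; ring.
  by rewrite -!enorm_sqr; field.
by rewrite mulr_ge0 ?invr_ge0// sumr_ge0// => i _; exact: sqr_ge0.
Qed.

Lemma ler_enormD v w : enorm (v + w) <= enorm v + enorm w.
Proof.
rewrite -(@ler_pXn2r _ 2)// ?nnegrE ?addr_ge0 ?enorm_ge0//.
rewrite enorm_sqr edotDr (edotC _ v) (edotC _ w) !edotDr -!enorm_sqr (edotC w).
by have := edot_le v w; lra.
Qed.

Lemma ler_enormB v w : enorm (v - w) <= enorm v + enorm w.
Proof. by rewrite (le_trans (ler_enormD _ _))// enormN. Qed.

Lemma ler_enorm_sum (I : Type) (r : seq I) (P : pred I) (F : I -> 'cV[R]_n) :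
  enorm (\sum_(i <- r | P i) F i) <= \sum_(i <- r | P i) enorm (F i).
Proof.
apply: (big_ind2 (fun v a => enorm v <= a)) => //; first by rewrite enorm0.
by move=> v a w b va wb; rewrite (le_trans (ler_enormD _ _))// lerD.
Qed.

Lemma enorm_delta (i : 'I_n) : enorm (delta_mx i 0 : 'cV[R]_n) = 1.
Proof.
rewrite /enorm (bigD1 i)//= big1 ?addr0 ?mxE ?eqxx ?expr1n ?sqrtr1//.
by move=> j /negbTE ji; rewrite mxE ji expr0n.
Qed.

Lemma enorm_le_sum v : enorm v <= \sum_i `|v i 0|.
Proof.
rewrite {1}[v]matrix_sum_delta (le_trans (ler_enorm_sum _ _ _))//.
apply: ler_sum => i _; rewrite big_ord1.
by rewrite enormZ enorm_delta mulr1.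
Qed.

Lemma normr_le_enorm v : `|v| <= enorm v.
Proof.
rewrite [leLHS]mx_normrE; apply: bigmax_le => [|ij _]; first exact: enorm_ge0.
by case: ij => i j /=; rewrite ord1 coord_le_enorm.
Qed.

Lemma coord_le_normr v i : `|v i 0| <= `|v|.
Proof. by rewrite [leRHS]mx_normrE; exact: (le_bigmax _ _ (i, 0)). Qed.

Lemma enorm_le_normr v : enorm v <= n%:R * `|v|.
Proof.
rewrite (le_trans (enorm_le_sum v))// (@le_trans _ _ (\sum_(i < n) `|v|))//.
  by apply: ler_sum => i _; exact: coord_le_normr.
by rewrite sumr_const card_ord mulr_natl.
Qed.

(** A crude bound, which turns entrywise information on matrix power series into
    estimates for the Euclidean norm. *)
Lemma enorm_mulmx_le_entries A v (a : R) : (forall i j, `|A i j| <= a) ->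
  enorm (A *m v) <= n%:R * n%:R * a * enorm v.
Proof.
move=> Aa; rewrite (le_trans (enorm_le_sum _))//.
have -> : n%:R * n%:R * a * enorm v =
    \sum_(i < n) \sum_(j < n) a * enorm v :> R.
  by rewrite !sumr_const card_ord -!mulrnA -[RHS]mulr_natl natrM !mulrA.
apply: ler_sum => i _; rewrite mxE (le_trans (ler_norm_sum _ _ _))//.
by apply: ler_sum => j _; rewrite normrM ler_pM// coord_le_enorm.
Qed.

Lemma entries_bounded A : exists2 a, 0 <= a & forall i j, `|A i j| <= a.
Proof.
exists (\sum_i \sum_j `|A i j|).
  by apply: sumr_ge0 => i _; apply: sumr_ge0.
move=> i j; rewrite (bigD1 i)//= (bigD1 j)//= -addrA lerDl addr_ge0//.
  by apply: sumr_ge0.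
by apply: sumr_ge0 => k _; apply: sumr_ge0.
Qed.

Let unit_image A := [set enorm (A *m v) | v in [set v | enorm v <= 1]].

Let unit_image_has_sup A : has_sup (unit_image A).
Proof.
split; first by exists (enorm (A *m 0)); exists 0 => //=; rewrite enorm0.
have [a a0 Aa] := entries_bounded A; exists (n%:R * n%:R * a) => _ [v v1 <-].
rewrite (le_trans (enorm_mulmx_le_entries _ Aa))// ler_piMr//.
by rewrite !mulr_ge0.
Qed.

Lemma mxnorm2_ge0 A : 0 <= mxnorm2 A.
Proof.
apply: (le_trans (enorm_ge0 (A *m 0))); apply: ub_le_sup.
  by have [] := unit_image_has_sup A.
by exists 0 => //=; rewrite enorm0.
Qed.

(** The supremum that defines the induced norm is over a nonempty bounded set, so
    it bounds A on the unit ball, hence on all vectors by homogeneity. *)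
Lemma enorm_mulmx A v : enorm (A *m v) <= mxnorm2 A * enorm v.
Proof.
have [v0|v0] := eqVneq (enorm v) 0.
  by rewrite (enorm0_eq0 v0) mulmx0 enorm0 mulr0.
have v_gt0 : 0 < enorm v by rewrite lt_neqAle eq_sym v0 enorm_ge0.
rewrite -ler_pdivrMr// mulrC -[_^-1]ger0_norm ?invr_ge0 ?enorm_ge0//.
rewrite -enormZ scalemxAr; apply: ub_le_sup.
  by have [] := unit_image_has_sup A.
exists ((enorm v)^-1 *: v) => //=.
by rewrite enormZ ger0_norm ?invr_ge0 ?enorm_ge0// mulVf.
Qed.

Lemma enorm_mulmx_le A v (a : R) : mxnorm2 A <= a ->
  enorm (A *m v) <= a * enorm v.
Proof.
by move=> Aa; rewrite (le_trans (enorm_mulmx A v))// ler_wpM2r// enorm_ge0.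
Qed.

Lemma ler_dist_enorm v w : `|enorm v - enorm w| <= enorm (v - w).
Proof.
rewrite ler_norml; have := ler_enormD (v - w) w; rewrite subrK.
by have := ler_enormD (w - v) v; rewrite subrK enorm_distC; lra.
Qed.

(** The topology on vectors is that of the max norm; this and
    [normr_le_enorm] say that it is also the Euclidean one. *)
Lemma near_enorm v (e : R) : 0 < e -> \forall w \near v, enorm (v - w) < e.
Proof.
move=> e0; apply/nbhs_normP; exists (e / n.+1%:R); first by rewrite /= divr_gt0.
move=> w /=; rewrite ltr_pdivlMr// mulrC => vw.
rewrite (le_lt_trans (enorm_le_normr _))//; apply: le_lt_trans vw.
by rewrite ler_wpM2r// ler_nat.
Qed.

Lemma continuous_enorm : continuous (@enorm R n).
Proof.
move=> v; apply/(@cvgrPdist_lt _ _ _ (nbhs v) (nbhs_filter v)) => e e0.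
apply: filterS (near_enorm v e0) => w.
exact: le_lt_trans (ler_dist_enorm _ _).
Qed.

End EuclideanNorm.

(** * Continuous curves and bounded functionals on them *)
Lemma cvg_mx_entries {R : realType} {m p : nat} {T : Type} (F : set_system T)
    {FF : Filter F} (f : T -> 'M[R]_(m, p)) (l : 'M[R]_(m, p)) :
  (forall i j, f t i j @[t --> F] --> l i j) -> f t @[t --> F] --> l.
Proof.
move=> fl W [P lP PW].
have : \forall t \near F, forall i j, P i j (f t i j).
  by apply: filter_forall => i; apply: filter_forall => j; exact/fl/lP.
by apply: filterS => t Pt; exact: PW.
Qed.

Section CurveSpace.
Context {R : realType} {n : nat}.
Implicit Types (x y : R -> 'cV[R]_n) (A : set R).

Lemma within_continuous_enormP A x :
  {within A, continuous x} <->
  forall s, A s -> forall e, 0 < e ->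
    exists2 d, 0 < d & forall t, A t -> `|s - t| < d -> enorm (x s - x t) < e.
Proof.
rewrite subspace_continuousP; split=> xc s As.
  move=> e e0; have := xc s As _ (near_enorm (x s) e0).
  move=> /nbhs_normP[d /= d0 dx]; exists d => // t At st.
  exact: dx.
apply/cvgrPdist_lt => e e0.
have [d d0 dx] := xc s As e e0; apply/nbhs_normP; exists d => //= t st At.
by rewrite (le_lt_trans (normr_le_enorm _))// dx.
Qed.

Lemma within_continuous_coordP A x :
  {within A, continuous x} <->
  forall i, {within A, continuous (fun t => x t i 0)}.
Proof.
split=> [xc i|xc].
  apply/subspace_continuousP => s As.
  move/subspace_continuousP : xc => /(_ s As) xs.
  by apply: (cvg_comp x (fun M : 'cV[R]_n => M i 0) xs); exact: coord_continuous.
apply/subspace_continuousP => s As; apply: cvg_mx_entries => i j; rewrite ord1.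
by have /subspace_continuousP := xc i; exact.
Qed.

Lemma continuous_mx_bounded (M : R -> 'M[R]_n) (a b : R) : a <= b ->
  (forall i j, continuous (fun t => M t i j)) ->
  exists2 K, 0 <= K & forall t, t \in `[a, b] -> forall i j, `|M t i j| <= K.
Proof.
move=> ab Mc; pose S t := \sum_i \sum_j `|M t i j|.
have entryS t i j : `|M t i j| <= S t.
  rewrite /S (bigD1 i)//= (bigD1 j)//= -addrA lerDl addr_ge0//.
    by apply: sumr_ge0.
  by apply: sumr_ge0 => k _; apply: sumr_ge0.
have Sc : {within `[a, b], continuous S}.
  apply: continuous_subspaceT => t.
  apply: cvg_big => [|i _]; first exact: add_continuous.
  apply: cvg_big => [|j _]; first exact: add_continuous.
  by apply: cvg_norm; exact: Mc.
have [c _ Smax] := EVT_max ab Sc; exists (S c).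
  by apply: sumr_ge0 => i _; apply: sumr_ge0.
by move=> t /Smax tc i j; exact: le_trans tc.
Qed.

Variable tau : R.
Hypothesis tau_gt0 : 0 < tau.

Let itv0 : 0 \in `[0, tau].
Proof. by rewrite in_itv/= lexx ltW. Qed.

Lemma CX_setT D x : CX tau D x -> CX tau setT x.
Proof. by case. Qed.

Lemma CX_bounded D x : CX tau D x ->
  exists C, forall t, t \in `[0, tau] -> enorm (x t) <= C.
Proof.
move=> [xc _]; have : {within `[0, tau], continuous (fun t => enorm (x t))}.
  apply/subspace_continuousP => s As.
  move/subspace_continuousP : xc => /(_ s As) xs.
  by apply: (cvg_comp x (@enorm R n) xs); exact: continuous_enorm.
by move=> /(EVT_max (ltW tau_gt0))[c _ cmax]; exists (enorm (x c)).
Qed.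

Lemma enorm_le_supnorm D x t : CX tau D x -> t \in `[0, tau] ->
  enorm (x t) <= supnorm tau x.
Proof.
move=> /CX_bounded[C xC] t0; apply: ub_le_sup; last by exists t.
by exists C => _ [s s0 <-]; exact: xC.
Qed.

Lemma supnorm_le x C : (forall t, t \in `[0, tau] -> enorm (x t) <= C) ->
  supnorm tau x <= C.
Proof.
move=> xC; apply: ge_sup; first by exists (enorm (x 0)); exists 0.
by move=> _ [t t0 <-]; exact: xC.
Qed.

Lemma supnorm_ge0 D x : CX tau D x -> 0 <= supnorm tau x.
Proof. by move=> xX; exact: le_trans (enorm_ge0 _) (enorm_le_supnorm xX itv0). Qed.

Lemma CX_lin (a : R) D1 D2 x y : CX tau D1 x -> CX tau D2 y ->
  CX tau setT (fun t => a *: x t + y t).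
Proof.
move=> [xc _] [yc _]; split=> //; apply/subspace_continuousP => s As.
apply: cvgD; last by move/subspace_continuousP : yc; exact.
by apply: cvgZr; move/subspace_continuousP : xc; exact.
Qed.

Lemma CX_D D1 D2 x y : CX tau D1 x -> CX tau D2 y ->
  CX tau setT (fun t => x t + y t).
Proof.
move=> xX yX; rewrite (_ : (fun t => _) = fun t => 1 *: x t + y t).
  exact: CX_lin xX yX.
by apply/funext => t; rewrite scale1r.
Qed.

Lemma CX_B D1 D2 x y : CX tau D1 x -> CX tau D2 y ->
  CX tau setT (fun t => x t - y t).
Proof.
move=> xX yX; rewrite (_ : (fun t => _) = fun t => (-1) *: y t + x t).
  exact: CX_lin yX xX.
by apply/funext => t; rewrite scaleN1r addrC.
Qed.

Lemma CX_cst (D : set 'cV[R]_n) (v : 'cV[R]_n) : D v -> CX tau D (fun=> v).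
Proof. by move=> Dv; split=> //; apply: continuous_subspaceT => ?; exact: cvg_cst. Qed.

Lemma CX_eq D x y : CX tau D x -> (forall t, t \in `[0, tau] -> x t = y t) ->
  CX tau D y.
Proof.
move=> [xc xD] xy; split=> [|t t0]; last by rewrite -xy//; exact: xD.
by apply: subspace_eq_continuous xc => t; rewrite inE => t0; exact: xy.
Qed.

End CurveSpace.

Section BoundedFunctional.
Context {R : realType} {n : nat}.
Variables (tau : R) (B : (R -> 'cV[R]_n) -> 'cV[R]_n).
Hypothesis tau_gt0 : 0 < tau.
Hypothesis B_bl : bounded_linear_functional tau B.
Implicit Types x y : R -> 'cV[R]_n.

Lemma functionalB D1 D2 x y : CX tau D1 x -> CX tau D2 y ->
  B (fun t => x t - y t) = B x - B y.
Proof.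
move=> xX yX; have [+ _] := B_bl => /(_ (-1) y x (CX_setT yX) (CX_setT xX)).
rewrite scaleN1r addrC => <-; congr B.
by apply/funext => t; rewrite scaleN1r addrC.
Qed.

Lemma functionalD D1 D2 x y : CX tau D1 x -> CX tau D2 y ->
  B (fun t => x t + y t) = B x + B y.
Proof.
move=> xX yX; have [+ _] := B_bl => /(_ 1 x y (CX_setT xX) (CX_setT yX)).
rewrite scale1r => <-; congr B.
by apply/funext => t; rewrite scale1r.
Qed.

Lemma functional0 : B (fun=> 0) = 0.
Proof.
have X0 : CX tau setT (fun=> 0 : 'cV[R]_n) by exact: CX_cst.
by have := functionalB X0 X0; rewrite !subrr.
Qed.

Lemma functionalZ D (a : R) x : CX tau D x -> B (fun t => a *: x t) = a *: B x.
Proof.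
move=> xX; have X0 : CX tau setT (fun=> 0 : 'cV[R]_n) by exact: CX_cst.
have [+ _] := B_bl => /(_ a x _ (CX_setT xX) X0).
rewrite functional0 addr0 => <-; congr B.
by apply/funext => t; rewrite addr0.
Qed.

Lemma functional_eq D x y : CX tau D x ->
  (forall t, t \in `[0, tau] -> x t = y t) -> B x = B y.
Proof.
move=> xX xy; have yX := CX_eq xX xy.
apply/eqP; rewrite -subr_eq0; apply/eqP/enorm0_eq0/eqP.
rewrite eq_le enorm_ge0 andbT -(functionalB xX yX).
have [_ [C /(_ _ (CX_B xX yX))]] := B_bl; rewrite (_ : supnorm _ _ = 0) ?mulr0//.
apply/eqP; rewrite eq_le (supnorm_ge0 tau_gt0 (CX_B xX yX)) andbT.
by apply: supnorm_le => // t t0; rewrite xy// subrr enorm0.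
Qed.

Lemma functional_sum (I : Type) (r : seq I) (x_ : I -> R -> 'cV[R]_n) :
  (forall i, CX tau setT (x_ i)) ->
  B (fun t => \sum_(i <- r) x_ i t) = \sum_(i <- r) B (x_ i).
Proof.
move=> xX; pose S (s : seq I) t := \sum_(i <- s) x_ i t.
suff [] : CX tau setT (S r) /\ B (S r) = \sum_(i <- r) B (x_ i) by [].
elim: r => [|i r [SX IH]].
  have -> : S [::] = fun=> 0 by apply/funext => t; rewrite /S big_nil.
  by rewrite big_nil functional0; split => //; exact: CX_cst.
have -> : S (i :: r) = fun t => x_ i t + S r t.
  by apply/funext => t; rewrite /S big_cons.
rewrite big_cons (functionalD (xX i) SX) IH; split => //.
exact: CX_D (xX i) SX.
Qed.

Let ball0 := [set enorm (B x) | x in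
  [set x | [/\ CX tau setT x, x 0 = 0 & supnorm tau x <= 1]]].

Let ball0_ubound : has_ubound ball0.
Proof.
have [_ [C BC]] := B_bl; exists `|C| => _ [x [xX _ x1] <-].
rewrite (le_trans (BC x xX))//.
have s0 := supnorm_ge0 tau_gt0 xX.
by rewrite (le_trans (ler_wpM2r s0 (ler_norm C)))// ler_piMr.
Qed.

Lemma opnorm0_ge0 : 0 <= opnorm0 tau B.
Proof.
apply: le_trans (enorm_ge0 (B (fun=> 0))) _; apply: ub_le_sup => //.
exists (fun=> 0) => //; split => //; first exact: CX_cst.
by apply: supnorm_le => // t _; rewrite enorm0.
Qed.

(** The unit ball in the definition of the norm is that of curves vanishing at 0;
    a curve bounded by C > 0 is rescaled into it, while for C = 0 the curve is
    zero on the interval and so is its image. *)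
Lemma enorm_functional_le D x (C : R) : CX tau D x -> x 0 = 0 ->
  (forall t, t \in `[0, tau] -> enorm (x t) <= C) ->
  enorm (B x) <= opnorm0 tau B * C.
Proof.
move=> xX x0 xC; have C0 : 0 <= C.
  by apply: le_trans (xC 0 _); rewrite ?enorm_ge0// in_itv/= lexx ltW.
have [C0'|Cn0] := eqVneq C 0.
  have -> : B x = B (fun=> 0).
    apply: functional_eq xX _ => t /xC; rewrite C0' => xt.
    by apply/enorm0_eq0/eqP; rewrite eq_le xt enorm_ge0.
  by rewrite functional0 enorm0 C0' mulr0.
have C_gt0 : 0 < C by rewrite lt_neqAle eq_sym Cn0.
rewrite -ler_pdivrMr// mulrC -[C^-1]ger0_norm ?invr_ge0// -enormZ.
rewrite -(functionalZ C^-1 xX); apply: ub_le_sup => //.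
exists (fun t => C^-1 *: x t) => //; split.
- have X0 : CX tau setT (fun=> 0 : 'cV[R]_n) by exact: CX_cst.
  apply: CX_eq (CX_lin C^-1 xX X0) _ => t _.
  by rewrite addr0.
- by rewrite x0 scaler0.
- apply: supnorm_le => // t t0.
  by rewrite enormZ ger0_norm ?invr_ge0// mulrC ler_pdivrMr// mul1r xC.
Qed.

End BoundedFunctional.

(** * The matrix exponential *)

(** Each entry of e^{tA} is a scalar power series in t, so that termwise
    differentiation of scalar power series applies. It is convenient to treat at
    once the entries of M e^{tA} for all M, because differentiating replaces M
    by M A. *)
Section MatrixExponential.
Context {R : realType} {n : nat}.
Variable A : 'M[R]_n.
Implicit Types (M : 'M[R]_n) (s t d : R).

Let coef M (i j : 'I_n) (k : nat) : R := (k`!%:R)^-1 * (M *m A ^+ k) i j.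

Let coef_bounded M i j : exists2 ab : R * R, 0 <= ab.1 /\ 0 <= ab.2 &
  forall k, `|coef M i j k| <= (k`!%:R)^-1 * (ab.1 * ab.2 ^+ k).
Proof.
have [a a0 Aa] := entries_bounded A; have [m m0 Mm] := entries_bounded M.
exists (m, n%:R * a); first by rewrite /= mulr_ge0.
move=> k; rewrite /coef normrM ger0_norm ?invr_ge0// ler_wpM2l ?invr_ge0//=.
elim: k => [|k IH] in M m m0 Mm i *; first by rewrite expr0 mulmx1 mulr1.
have MA : forall i j, `|(M *m A) i j| <= n%:R * a * m.
  move=> i' j'; rewrite mxE (le_trans (ler_norm_sum _ _ _))//.
  rewrite (@le_trans _ _ (\sum_(l < n) a * m))//.
    by apply: ler_sum => l _; rewrite normrM mulrC ler_pM.
  by rewrite sumr_const card_ord -[leLHS]mulr_natl mulrA.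
rewrite exprS -mulmxE mulmxA.
have nam0 : 0 <= n%:R * a * m by rewrite !mulr_ge0.
apply: (le_trans (IH _ _ nam0 MA i)).
by rewrite exprS mulrA (mulrC m).
Qed.

Let cvg_coef M i j t : cvgn (pseries (coef M i j) t).
Proof.
have [[m b] [/= m0 b0] Mb] := coef_bounded M i j.
apply: normed_cvg.
apply: (@series_le_cvg _ _ (m *: exp_coeff (b * `|t|))) => /=.
- by move=> k.
- move=> k; rewrite /exp_coeff /= mulr_ge0// divr_ge0// exprn_ge0// mulr_ge0//.
- move=> k; rewrite normrM normrX.
  rewrite (le_trans (ler_wpM2r _ (Mb k)))// ?exprn_ge0//.
  rewrite [leRHS](_ : _ = m * ((b * `|t|) ^+ k / k`!%:R))// exprMn.
  by rewrite le_eqVlt; apply/orP; left; apply/eqP; ring.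
- by apply: is_cvg_seriesZ; exact: is_cvg_series_exp_coeff.
Qed.

Let coef_diffs M i j : pseries_diffs (coef M i j) = coef (M *m A) i j.
Proof.
apply/funext => k; rewrite /pseries_diffs /coef factS natrM invfM.
by rewrite exprS -mulmxE mulmxA mulrA mulVKf.
Qed.

Let lim_coef_mull M i j t : limn (pseries (coef M i j) t) =
  \sum_l M i l * limn (pseries (coef 1%:M l j) t).
Proof.
apply: cvg_lim => //.
rewrite (_ : pseries _ _ = fun N => \sum_l M i l * pseries (coef 1%:M l j) t N).
  apply: cvg_big => [|l _]; first exact: add_continuous.
  by apply: cvgMr; exact: cvg_coef.
apply/funext => N; rewrite /pseries /series /=.
under [RHS]eq_bigr do rewrite mulr_sumr.
rewrite exchange_big/=; apply: eq_bigr => k _.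
rewrite /coef [in LHS]mxE mulr_sumr mulr_suml; apply: eq_bigr => l _.
by rewrite mul1mx; ring.
Qed.

Let exprZmx t k : (t *: A) ^+ k = t ^+ k *: A ^+ k.
Proof.
elim: k => [|k IH]; first by rewrite !expr0 scale1r.
by rewrite !exprS IH -!mulmxE -scalemxAl -scalemxAr scalerA.
Qed.

Lemma expmx_entryE t i j : expmx (t *: A) i j = limn (pseries (coef 1%:M i j) t).
Proof.
suff -> : expmx (t *: A) = \matrix_(i, j) limn (pseries (coef 1%:M i j) t).
  by rewrite mxE.
apply: cvg_lim; first exact: norm_hausdorff.
apply: cvg_mx_entries => i' j'; rewrite mxE.
rewrite (_ : (fun N => _) = pseries (coef 1%:M i' j') t); first exact: cvg_coef.
apply/funext => N; rewrite /pseries /series /= summxE; apply: eq_bigr => k _.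
by rewrite /coef mul1mx exprZmx !mxE; ring.
Qed.

Lemma is_derive_mulmx_expmx M i j t : is_derive t (1 : R)
  (fun t => (M *m expmx (t *: A)) i j) ((M *m A *m expmx (t *: A)) i j).
Proof.
have E N s : (N *m expmx (s *: A)) i j = limn (pseries (coef N i j) s).
  by rewrite lim_coef_mull mxE; apply: eq_bigr => l _; rewrite expmx_entryE.
rewrite E -coef_diffs.
rewrite (_ : (fun t => _) = fun s => limn (pseries (coef M i j) s)); last first.
  by apply/funext => s; rewrite E.
apply: (@pseries_snd_diffs _ _ (`|t| + 1)); rewrite ?coef_diffs; try exact: cvg_coef.
by rewrite [X in _ < X]ger0_norm ?addr_ge0// ltrDl.
Qed.

Lemma expmx_comm t : A *m expmx (t *: A) = expmx (t *: A) *m A.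
Proof.
apply/matrixP => i j.
have -> : (A *m expmx (t *: A)) i j = limn (pseries (coef A i j) t).
  by rewrite lim_coef_mull mxE; apply: eq_bigr => l _; rewrite expmx_entryE.
apply: cvg_lim => //; rewrite mxE.
rewrite (_ : pseries _ _ = fun N => \sum_l pseries (coef 1%:M i l) t N * A l j).
  apply: cvg_big => [|l _]; first exact: add_continuous.
  by apply: cvgMl; rewrite expmx_entryE; exact: cvg_coef.
apply/funext => N; rewrite /pseries /series /=.
under [RHS]eq_bigr do rewrite mulr_suml.
rewrite exchange_big/=; apply: eq_bigr => k _.
rewrite /coef mulmxE -exprS exprSr -mulmxE [in LHS]mxE mulr_sumr mulr_suml.
by apply: eq_bigr => l _; rewrite mul1mx; ring.
Qed.

Lemma expmx0 : expmx (0 *: A) = 1%:M.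
Proof.
apply/matrixP => i j; rewrite expmx_entryE.
apply: lim_near_cst => //; near=> N.
rewrite -[N]prednK; last by near: N; exact: nbhs_infty_gt.
rewrite /pseries /series /= big_nat_recl//= big1 ?addr0.
  by rewrite /coef fact0 invr1 mul1r expr0 mulmx1 expr0 mulr1.
by move=> k _; rewrite exprS mul0r mulr0.
Unshelve. all: by end_near. Qed.

Lemma is_derive_expmx i j t : is_derive t (1 : R)
  (fun t => expmx (t *: A) i j) ((A *m expmx (t *: A)) i j).
Proof.
have := is_derive_mulmx_expmx 1%:M i j t; rewrite mul1mx.
by congr is_derive; apply/funext => s; rewrite mul1mx.
Qed.

(** The derivative of s |-> e^{-sA} e^{(s+t)A} vanishes since A commutes with
    its exponentials; the value at s = 0 is e^{tA}. The group law follows. *)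
Let expmxN_mul s t : expmx (- s *: A) *m expmx ((s + t) *: A) = expmx (t *: A).
Proof.
apply/matrixP => i j.
pose F r := \sum_l expmx (- r *: A) i l * expmx ((r + t) *: A) l j.
have -> : (expmx (- s *: A) *m expmx ((s + t) *: A)) i j = F s by rewrite mxE.
transitivity (F 0); last first.
  have := congr1 (fun M => M i j) (mul1mx (expmx (t *: A))).
  by rewrite /= mxE -expmx0 => <-; apply: eq_bigr => l _; rewrite oppr0 add0r.
apply: is_derive_0_is_cst => r.
have D1 l : is_derive r (1 : R) (fun r => expmx (- r *: A) i l)
    (- (expmx (- r *: A) *m A) i l).
  have := is_derive_expmx i l (- r); rewrite expmx_comm => Di.
  have := is_derive1_comp Di (is_deriveN (is_derive_id r (1 : R))).
  by rewrite mulrN1.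
have D2 l : is_derive r (1 : R) (fun r => expmx ((r + t) *: A) l j)
    ((A *m expmx ((r + t) *: A)) l j).
  have := @is_derive1_comp R (fun q => expmx (q *: A) l j) (shift t) r _ _
    (is_derive_expmx l j (r + t)) (is_derive_shift r 1 t).
  by rewrite mulr1.
rewrite (_ : F = \sum_l (fun r => expmx (- r *: A) i l) *
    (fun r => expmx ((r + t) *: A) l j)); last first.
  by apply/funext => q; rewrite /F fct_sumE.
apply: is_derive_eq (is_derive_sum (fun l => is_deriveM (D1 l) (D2 l))) _.
rewrite big_split/= /GRing.scale/=.
transitivity ((expmx (- r *: A) *m (A *m expmx ((r + t) *: A))) i j
  - ((expmx (- r *: A) *m A) *m expmx ((r + t) *: A)) i j); last first.
  by rewrite mulmxA subrr.
rewrite !mxE; congr (_ + _); rewrite -sumrN.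
by apply: eq_bigr => l _; rewrite mulrN mulrC.
Qed.

Lemma expmxD s t : expmx ((s + t) *: A) = expmx (s *: A) *m expmx (t *: A).
Proof.
have := expmxN_mul (- s) (s + t).
by rewrite opprK addKr => ->.
Qed.

Lemma expmxNK t : expmx (- t *: A) *m expmx (t *: A) = 1%:M.
Proof. by rewrite -expmxD addNr expmx0. Qed.

Lemma continuous_expmx i j : continuous (fun t => expmx (t *: A) i j).
Proof.
move=> t; apply: differentiable_continuous; apply/derivable1_diffP.
by have [] := is_derive_expmx i j t.
Qed.

Let dist_le_derive (f df : R -> R) d (K : R) : 0 <= d ->
    (forall t, is_derive t (1 : R) f (df t)) ->
    (forall t, t \in `[0, d] -> `|df t| <= K) ->
  `|f d - f 0| <= K * d.
Proof.
move=> d0 Df dfK.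
have fc : {within `[0, d], continuous f}.
  apply: continuous_subspaceT => t.
  apply: differentiable_continuous; apply/derivable1_diffP.
  by have [] := Df t.
have [c c0 ->] := MVT_segment d0 (fun t _ => Df t) fc.
by rewrite subr0 normrM (ger0_norm d0) ler_wpM2r// dfK.
Qed.

Let entry_mulmx_le M (N : 'M[R]_n) (a b : R) : (forall i j, `|M i j| <= a) ->
    (forall i j, `|N i j| <= b) ->
  forall i j, `|(M *m N) i j| <= n%:R * (a * b).
Proof.
move=> Ma Nb i j; rewrite mxE (le_trans (ler_norm_sum _ _ _))//.
rewrite (@le_trans _ _ (\sum_(l < n) a * b))//.
  by apply: ler_sum => l _; rewrite normrM ler_pM.
by rewrite sumr_const card_ord -[leLHS]mulr_natl.
Qed.

Variable T : R.
Hypothesis T_ge0 : 0 <= T.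

(** Boundedness and Taylor expansion at 0 to orders one and two, with a single
    constant on [0, T]. Each order follows from the preceding one by the mean
    value theorem, as the derivative of e^{dA} - 1 - dA is A (e^{dA} - 1). *)
Lemma expmx_estimates : exists2 K, 0 <= K & forall d (v : 'cV[R]_n),
  d \in `[0, T] ->
  [/\ enorm (expmx (d *: A) *m v) <= K * enorm v,
      enorm ((expmx (d *: A) - 1%:M) *m v) <= K * d * enorm v &
      enorm ((expmx (d *: A) - 1%:M - d *: A) *m v) <= K * d ^+ 2 * enorm v].
Proof.
have [K0 K0_ge0 EK0] :=
  continuous_mx_bounded T_ge0 continuous_expmx.
have [a a0 Aa] := entries_bounded A.
pose K1 := n%:R * (a * K0); pose K2 := n%:R * (a * K1).
have K1_ge0 : 0 <= K1 by rewrite !mulr_ge0.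
have K2_ge0 : 0 <= K2 by rewrite !mulr_ge0.
have sub t d : d \in `[0, T] -> t \in `[0, d] -> t \in `[0, T].
  by rewrite !in_itv/= => /andP[_ dT] /andP[-> td]; exact: le_trans dT.
have E1 d : d \in `[0, T] -> forall i j,
    `|(expmx (d *: A) - 1%:M) i j| <= K1 * d.
  move=> dT i j; rewrite -expmx0 !mxE.
  apply: (dist_le_derive _ (is_derive_expmx i j)).
    by move: dT; rewrite in_itv/= => /andP[].
  move=> t td; apply: entry_mulmx_le => //; exact/EK0/sub/td.
have E2 d : d \in `[0, T] -> forall i j,
    `|(expmx (d *: A) - 1%:M - d *: A) i j| <= K2 * d ^+ 2.
  move=> dT i j; have d0 : 0 <= d by move: dT; rewrite in_itv/= => /andP[].
  pose f t := expmx (t *: A) i j - t * A i j.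
  have -> : (expmx (d *: A) - 1%:M - d *: A) i j = f d - f 0.
    by rewrite /f expmx0 !mxE; ring.
  rewrite expr2 mulrA.
  apply: (@dist_le_derive _ (fun t => (A *m (expmx (t *: A) - 1%:M)) i j)) => //.
    move=> t; rewrite mulmxBr mulmx1 mxE [X in _ + X]mxE.
    apply: is_deriveB; first exact: is_derive_expmx.
    rewrite -[X in is_derive _ _ _ X]mulr1.
    have := is_deriveZ (A i j) (is_derive_id t (1 : R)).
    congr (is_derive _ _ _ _).
    by apply/funext => q; rewrite [LHS]mulrC.
  move=> t td; rewrite (_ : K2 * d = n%:R * (a * (K1 * d))); last by rewrite /K2 !mulrA.
  apply: entry_mulmx_le => // k l.
  apply: le_trans (E1 _ (sub _ _ dT td) _ _) _.
  by move: td; rewrite in_itv/= => /andP[t0 td]; rewrite ler_wpM2l.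
pose N2 : R := n%:R * n%:R; have N2_ge0 : 0 <= N2 by rewrite mulr_ge0.
have le_K (k : R) q r : 0 <= q -> k <= K0 + K1 + K2 ->
    r <= N2 * (k * q) -> r <= N2 * (K0 + K1 + K2) * q.
  move=> q0 kK rk; apply: le_trans rk _.
  by rewrite -mulrA ler_wpM2l// ler_wpM2r.
exists (N2 * (K0 + K1 + K2)); first by rewrite mulr_ge0// !addr_ge0.
move=> d v dT; have d0 : 0 <= d by move: dT; rewrite in_itv/= => /andP[].
have v0 := enorm_ge0 v; split.
- apply: (le_K K0) => //; first by lra.
  by rewrite mulrA; apply: enorm_mulmx_le_entries; exact: EK0.
- rewrite -mulrA; apply: (le_K K1); rewrite ?mulr_ge0//; first by lra.
  apply: le_trans (enorm_mulmx_le_entries v (E1 d dT)) _.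
  by rewrite !mulrA.
- rewrite -mulrA; apply: (le_K K2); rewrite ?mulr_ge0 ?sqr_ge0//; first by lra.
  apply: le_trans (enorm_mulmx_le_entries v (E2 d dT)) _.
  by rewrite !mulrA.
Qed.

End MatrixExponential.

(** * Integration of essentially bounded curves *)
Section VectorIntegral.
Context {R : realType} {n : nat}.
Variable tau : R.
Hypothesis tau_gt0 : 0 < tau.
Implicit Types (f h x : R -> 'cV[R]_n) (a b c s t : R).
Local Notation mu := (@lebesgue_measure R).

#[local] Instance ae_lebesgue_filter : Filter (nbhs (almost_everywhere mu)) :=
  ae_filter_ringOfSetsType mu.

Lemma measurable_continuous_within (f : R -> R) a b :
  {within `[a, b], continuous f} -> measurable_fun `[a, b] f.
Proof. by move=> fc; apply: subspace_continuous_measurable_fun. Qed.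

Lemma CX_Linfty D x : CX tau D x -> in_Linfty tau x.
Proof.
move=> xX; split=> [i|].
  apply: measurable_continuous_within.
  by case: xX => /within_continuous_coordP.
by have [C xC] := CX_bounded tau_gt0 xX; exists C; exact: aeW.
Qed.

Lemma LinftyD f h : in_Linfty tau f -> in_Linfty tau h ->
  in_Linfty tau (fun t => f t + h t).
Proof.
move=> [fm [C fC]] [hm [C' hC]]; split=> [i|].
  rewrite (_ : (fun t => _) = (fun t => f t i 0) \+ (fun t => h t i 0)).
    exact: measurable_funD.
  by apply/funext => t; rewrite mxE.
exists (C + C'); apply: filterS2 fC hC => t ft ht t0.
by rewrite (le_trans (ler_enormD _ _))// lerD ?ft ?ht.
Qed.

Lemma Linfty_mulmx (M : R -> 'M[R]_n) f :
  (forall i j, continuous (fun t => M t i j)) -> in_Linfty tau f ->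
  in_Linfty tau (fun t => M t *m f t).
Proof.
move=> Mc [fm [C fC]]; split=> [i|].
  rewrite (_ : (fun t => _) =
      fun t => \sum_j ((fun t => M t i j) \* (fun t => f t j 0)) t).
    apply: measurable_sum => j; apply: measurable_funM => //.
    apply: measurable_continuous_within; exact: continuous_subspaceT.
  by apply/funext => t; rewrite mxE.
have [K K0 MK] := continuous_mx_bounded (ltW tau_gt0) Mc.
exists (n%:R * n%:R * K * C); apply: filterS fC => t ft t0.
rewrite (le_trans (enorm_mulmx_le_entries _ (MK t t0)))//.
by rewrite ler_wpM2l ?mulr_ge0// ft.
Qed.

Lemma LinftyN f : in_Linfty tau f -> in_Linfty tau (fun t => - f t).
Proof.
move=> fL; have := @Linfty_mulmx (fun=> -1%:M) f.
rewrite (_ : (fun t => _ *m _) = fun t => - f t); last first.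
  by apply/funext => t; rewrite mulNmx mul1mx.
by apply => // i j t; exact: cvg_cst.
Qed.

Lemma LinftyB f h : in_Linfty tau f -> in_Linfty tau h ->
  in_Linfty tau (fun t => f t - h t).
Proof. by move=> fL hL; exact: LinftyD fL (LinftyN hL). Qed.

Section OnSubinterval.
Variables (a b : R).
Hypotheses (a_ge0 : 0 <= a) (a_le_b : a <= b) (b_le_tau : b <= tau).

Let sub_itv : `[a, b] `<=` `[0, tau].
Proof.
move=> s /=; rewrite !in_itv/= => /andP[as_ sb].
by rewrite (le_trans a_ge0)//= (le_trans sb).
Qed.

Let mu_itv : mu `[a, b] = (b - a)%:E.
Proof.
rewrite lebesgue_measure_itv/= lte_fin; case: ltP => //.
by move=> ba; rewrite (@le_anti _ _ a b) ?a_le_b// subrr.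
Qed.

(** An almost everywhere bound suffices on an interval of finite length. *)
Lemma Linfty_integrable f i : in_Linfty tau f ->
  mu.-integrable `[a, b] (EFin \o (fun s => f s i 0)).
Proof.
move=> [fm [C fC]].
have fmab : measurable_fun `[a, b] (EFin \o (fun s => f s i 0)).
  apply/measurable_EFinP; exact: measurable_funS (fm i).
apply/integrableP; split=> //.
have : (\int[mu]_(s in `[a, b]) `|(EFin \o (fun s => f s i 0%R)) s|
    <= `|C|%:E * mu `[a, b])%E.
  apply: integral_le_bound => //; apply: filterS fC => s fs sab.
  rewrite lee_fin (le_trans (coord_le_enorm _ _))// (le_trans _ (ler_norm C))//.
  by apply: fs; exact: sub_itv.
by move=> /le_lt_trans; apply; rewrite mu_itv -EFinM ltry.
Qed.

Lemma eq_vint f h : (forall s, s \in `[a, b] -> f s = h s) ->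
  vint a b f = vint a b h.
Proof.
move=> fh; apply/matrixP => i j; rewrite !mxE; apply: eq_Rintegral => s.
by rewrite inE => sab; rewrite fh.
Qed.

Lemma vintD f h : in_Linfty tau f -> in_Linfty tau h ->
  vint a b (fun s => f s + h s) = vint a b f + vint a b h.
Proof.
move=> fL hL; apply/matrixP => i j; rewrite !mxE.
rewrite -RintegralD//; try exact: Linfty_integrable.
by apply: eq_Rintegral => s _; rewrite mxE.
Qed.

Lemma Linfty_integrable_edot w f : in_Linfty tau f ->
  mu.-integrable `[a, b] (EFin \o (fun s => edot w (f s))).
Proof.
move=> fL.
have -> : EFin \o (fun s => edot w (f s)) =
    fun s => (\sum_k (w k 0%R)%:E * (f s k 0%R)%:E)%E.
  by apply/funext => s /=; rewrite -sumEFin; apply: eq_bigr => k _; rewrite EFinM.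
apply: integrable_sum => // k _.
by apply: integrableZl => //; exact: Linfty_integrable.
Qed.

Lemma Rintegral_edot w f : in_Linfty tau f ->
  \int[mu]_(s in `[a, b]) edot w (f s) = edot w (vint a b f).
Proof.
move=> fL; rewrite /Rintegral.
have fi k : mu.-integrable `[a, b] (EFin \o (fun s => f s k 0)).
  exact: Linfty_integrable.
have wfi k : mu.-integrable `[a, b] (fun s => (w k 0%R)%:E * (f s k 0%R)%:E)%E.
  by apply: integrableZl => //; exact: fi.
transitivity (fine (\int[mu]_(s in `[a, b])
    (\sum_k (w k 0%R)%:E * (f s k 0%R)%:E))%E).
  congr fine; apply: eq_integral => s _.
  by rewrite -sumEFin; apply: eq_bigr => k _; rewrite EFinM.
rewrite integral_sum// -sum_fine; last by move=> k _; exact: integrable_fin_num.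
by apply: eq_bigr => k _; rewrite mxE -RintegralZl.
Qed.

Lemma vint_mulmx (M : 'M[R]_n) f : in_Linfty tau f ->
  vint a b (fun s => M *m f s) = M *m vint a b f.
Proof.
move=> fL; apply/matrixP => i j; rewrite ord1 mxE.
have rowE v : (M *m v) i 0 = edot (row i M)^T v.
  by rewrite mxE; apply: eq_bigr => k _; rewrite !mxE.
rewrite rowE -Rintegral_edot//.
by apply: eq_Rintegral => s _; rewrite rowE.
Qed.

Lemma vintB f h : in_Linfty tau f -> in_Linfty tau h ->
  vint a b (fun s => f s - h s) = vint a b f - vint a b h.
Proof.
move=> fL hL; rewrite vintD//; last exact: LinftyN.
congr (_ + _); rewrite -[RHS]mul1mx mulmxN -mulNmx -vint_mulmx//.
by apply: eq_vint => s _; rewrite mulNmx mul1mx.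
Qed.

Lemma vint_cst (v : 'cV[R]_n) : vint a b (fun=> v) = (b - a) *: v.
Proof.
apply/matrixP => i j; rewrite !mxE ord1 Rintegral_cst//= mulrC.
by rewrite -[X in fine (X _)]/mu mu_itv.
Qed.

(** With w the integral of f, pairing with w gives
    |w|^2 = int <w, f> <= |w| int k, so the Euclidean norm of the integral is
    bounded with constant 1; a coordinatewise estimate would lose a factor and
    spoil the contraction constant. *)
Lemma enorm_vint_le f (k : R -> R) : in_Linfty tau f ->
  mu.-integrable `[a, b] (EFin \o k) ->
  (forall s, s \in `[a, b] -> 0 <= k s) ->
  {ae mu, forall s, s \in `[a, b] -> enorm (f s) <= k s} ->
  enorm (vint a b f) <= \int[mu]_(s in `[a, b]) k s.
Proof.
move=> fL ki k0 fk; set w := vint a b f.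
have [->|w0] := eqVneq (enorm w) 0; first exact: Rintegral_ge0.
have w_gt0 : 0 < enorm w by rewrite lt_neqAle eq_sym w0 enorm_ge0.
rewrite -(ler_pM2l w_gt0) -expr2 enorm_sqr -Rintegral_edot// -RintegralZl//.
have wfi := Linfty_integrable_edot w fL.
apply: le_trans (ler_norm _) _; apply: le_trans (le_normr_Rintegral _ wfi) _ => //.
have wki : mu.-integrable `[a, b] (EFin \o (fun s => enorm w * k s)).
  exact: (integrableZl _ (enorm w) ki).
rewrite /Rintegral fine_le//.
- by apply: integrable_fin_num => //; exact: (integrable_norm wfi).
- exact: integrable_fin_num.
apply: ae_ge0_le_integral => //.
- apply/measurable_EFinP; apply: measurableT_comp => //.
  by apply/measurable_EFinP; case/integrableP : wfi.
- by move=> s sab; rewrite lee_fin mulr_ge0 ?enorm_ge0// k0.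
- by case/integrableP : wki.
- apply: filterS fk => s fs sab; rewrite lee_fin ler_norml.
  have fws : enorm w * enorm (f s) <= enorm w * k s by rewrite ler_pM2l// fs.
  rewrite (le_trans (edot_le _ _))// andbT lerNl -edotNr.
  by rewrite (le_trans (edot_le _ _))// enormN.
Qed.

Lemma enorm_vint_le_cst f (C : R) : in_Linfty tau f -> 0 <= C ->
  {ae mu, forall s, s \in `[a, b] -> enorm (f s) <= C} ->
  enorm (vint a b f) <= C * (b - a).
Proof.
move=> fL C0 fC; have -> : C * (b - a) = \int[mu]_(s in `[a, b]) C.
  by rewrite Rintegral_cst// -[X in fine (X _)]/mu mu_itv.
apply: enorm_vint_le => //; apply: measurable_bounded_integrable => //.
  by rewrite -[X in (X _ < _)%E]/mu mu_itv ltry.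
exists C; split; first exact: num_real.
by move=> r Cr s _ /=; rewrite ger0_norm// ltW.
Qed.

End OnSubinterval.

Lemma vint_split f a b : in_Linfty tau f -> 0 <= a -> a <= b -> b <= tau ->
  vint 0 b f = vint 0 a f + vint a b f.
Proof.
move=> fL a0 ab btau; apply/eqP; rewrite addrC -subr_eq; apply/eqP.
apply/matrixP => i j; rewrite !mxE.
have fi : mu.-integrable `[0, b] (EFin \o (fun s => f s i 0)).
  by apply: Linfty_integrable => //; exact: le_trans ab.
rewrite Rintegral_itvB//= ?bnd_simp// Rintegral_itv_obnd_cbnd//.
apply: integrableS fi => //; apply: subset_itv; rewrite bnd_simp//.
Qed.

Lemma vint_xx f a : vint a a f = 0.
Proof. by apply/matrixP => i j; rewrite !mxE set_itv1 Rintegral_set1. Qed.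

End VectorIntegral.

(** * Variation of constants *)
Section VariationOfConstants.
Context {R : realType} {n : nat}.
Variables (tau : R) (A : 'M[R]_n).
Hypothesis tau_gt0 : 0 < tau.
Implicit Types (h y : R -> 'cV[R]_n) (r s t : R).
Local Notation mu := (@lebesgue_measure R).
Local Notation E t := (expmx (t *: A)).

Definition lipschitz_curve y := exists2 C, 0 <= C &
  forall s t, 0 <= s -> s <= t -> t <= tau -> enorm (y t - y s) <= C * (t - s).

Lemma lipschitz_curve_CX y : lipschitz_curve y -> CX tau setT y.
Proof.
move=> [C C0 yC]; split=> //; apply/within_continuous_enormP => s.
rewrite /= in_itv/= => /andP[s0 stau] e e0.
have C1 : 0 < C + 1 by lra.
exists (e / (C + 1)); first by rewrite divr_gt0.
move=> t; rewrite /= in_itv/= => /andP[t0 ttau]; rewrite ltr_pdivlMr// => st.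
apply: le_lt_trans st; have st0 := normr_ge0 (s - t).
suff : enorm (y s - y t) <= C * `|s - t| by lra.
have [st|/ltW ts] := leP s t.
  by rewrite enorm_distC distrC ger0_norm ?subr_ge0// yC.
by rewrite ger0_norm ?subr_ge0// yC.
Qed.

(** Cutting [0, t] into N pieces bounds the total increment by N C (t/N)^2,
    which tends to 0. This replaces differentiation for curves that are only
    integrals of measurable functions. *)
Lemma eq_of_quadratic_increments y (C : R) : 0 <= C ->
  (forall s t, 0 <= s -> s <= t -> t <= tau ->
     enorm (y t - y s) <= C * (t - s) ^+ 2) ->
  forall t, t \in `[0, tau] -> y t = y 0.
Proof.
move=> C0 yC t; rewrite in_itv/= => /andP[t0 ttau].
apply/eqP; rewrite -subr_eq0; apply/eqP/enorm0_eq0/eqP.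
rewrite eq_le enorm_ge0 andbT; apply/ler_addgt0Pl => e e0; rewrite addr0.
(* N + 1 pieces suffice for a total increment below e. *)
have [N] : exists N : nat, C * t ^+ 2 / e < N.+1%:R.
  exists (Num.truncn (C * t ^+ 2 / e)); exact: truncnS_gt.
rewrite ltr_pdivrMr// => NP.
pose d := t / N.+1%:R; have d0 : 0 <= d by rewrite divr_ge0.
have Nd : N.+1%:R * d = t by rewrite mulrC divfK.
have step i : (i <= N.+1)%N -> enorm (y (i%:R * d) - y 0) <= i%:R * (C * d ^+ 2).
  elim: i => [|i IH] iN; first by rewrite !mul0r subrr enorm0.
  have -> : y (i.+1%:R * d) - y 0 =
      (y (i.+1%:R * d) - y (i%:R * d)) + (y (i%:R * d) - y 0).
    by rewrite addrA subrK.
  rewrite (le_trans (ler_enormD _ _))// -[in leRHS]nat1r mulrDl mul1r lerD//.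
    have := yC (i%:R * d) (i.+1%:R * d).
    have -> : i.+1%:R * d - i%:R * d = d by rewrite -natr1; ring.
    apply; first by rewrite mulr_ge0.
      by rewrite ler_wpM2r// ler_nat.
    by apply: le_trans ttau; rewrite -Nd ler_wpM2r// ler_nat.
  exact/IH/ltnW.
have := step _ (leqnn N.+1); rewrite Nd => /le_trans; apply.
have -> : N.+1%:R * (C * d ^+ 2) = C * t ^+ 2 / N.+1%:R.
  have : N.+1%:R != 0 :> R by rewrite pnatr_eq0.
  by rewrite /d; move: (N.+1%:R) => q q0; field.
by rewrite ler_pdivrMr// [leRHS]mulrC ltW.
Qed.

Lemma continuous_expmx_sub t i j : continuous (fun r => E (t - r) i j).
Proof.
move=> r; apply: (@continuous_comp _ _ _ (fun r => t - r) (fun q => E q i j)).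
  by apply: cvgB; [exact: cvg_cst|exact: cvg_id].
exact: continuous_expmx.
Qed.

(** The Duhamel integral, that is, the solution of y' = A y + h starting
    from 0. *)
Definition forced_response h t := vint 0 t (fun r => E (t - r) *m h r).

Section FixedForcing.
Variable h : R -> 'cV[R]_n.
Hypothesis h_Linfty : in_Linfty tau h.

Local Notation forced := (forced_response h).

Lemma Linfty_expmx_sub t : in_Linfty tau (fun r => E (t - r) *m h r).
Proof. by apply: Linfty_mulmx => //; exact: continuous_expmx_sub. Qed.

Let step_le : exists2 C, 0 <= C & forall s t, 0 <= s -> s <= t -> t <= tau ->
  [/\ enorm (vint s t (fun r => E (t - r) *m h r)) <= C * (t - s),
      enorm (vint s t (fun r => (E (t - r) - 1%:M) *m h r)) <= C * (t - s) ^+ 2 &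
      enorm (vint s t h) <= C * (t - s)].
Proof.
have [K K0 EK] := expmx_estimates A (ltW tau_gt0).
have [_ [C hC]] := h_Linfty.
exists ((K + 1) * `|C|); first by rewrite mulr_ge0// addr_ge0.
move=> s t s0 st ttau.
have sub r : r \in `[s, t] -> r \in `[0, tau] /\ t - r \in `[0, tau].
  by rewrite !in_itv/= => /andP[sr rt]; lra.
have FF := ae_lebesgue_filter (R := R).
have C0 := normr_ge0 C; have CC := ler_norm C.
have ts0 : 0 <= t - s by lra.
split.
- apply: (@enorm_vint_le_cst _ _ tau) => //; first exact: Linfty_expmx_sub.
    by rewrite mulr_ge0// addr_ge0.
  apply: filterS hC => r hr /sub[r0 tr0].
  have [/le_trans + _ _] := EK _ (h r) tr0; apply.
  have {}hr := hr r0; have := enorm_ge0 (h r) => h0.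
  by rewrite ler_pM//; lra.
- rewrite expr2 mulrA; apply: (@enorm_vint_le_cst _ _ tau) => //.
  + apply: Linfty_mulmx => // i j r; rewrite /continuous_at/=.
    have -> : (fun r => (E (t - r) - 1%:M) i j) =
        fun r => E (t - r) i j - (1%:M : 'M[R]_n) i j.
      by apply/funext => q; rewrite !mxE.
    rewrite [X in _ --> X]mxE [X in _ --> _ + X]mxE.
    by apply: cvgB; [exact: continuous_expmx_sub|exact: cvg_cst].
  + by rewrite !mulr_ge0// addr_ge0.
  apply: filterS hC => r hr rst; have [r0 tr0] := sub _ rst.
  have [_ /le_trans + _] := EK _ (h r) tr0; apply.
  have {}hr := hr r0; have h0 := enorm_ge0 (h r).
  move: rst; rewrite in_itv/= => /andP[sr rt].
  have -> : (K + 1) * `|C| * (t - s) = (K + 1) * (t - s) * `|C| by ring.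
  rewrite ler_pM//; [|apply: ler_pM => //|]; try lra.
  by rewrite mulr_ge0//; lra.
- apply: (@enorm_vint_le_cst _ _ tau) => //; first by rewrite mulr_ge0// addr_ge0.
  apply: filterS hC => r hr /sub[r0 _]; have {}hr := hr r0.
  by rewrite (le_trans hr)// (le_trans CC)// ler_peMl//; lra.
Qed.

Lemma forced_shift s t : 0 <= s -> s <= t -> t <= tau ->
  forced t = E (t - s) *m forced s + vint s t (fun r => E (t - r) *m h r).
Proof.
move=> s0 st ttau; rewrite /forced_response (@vint_split _ _ tau _ s)//; last first.
  exact: Linfty_expmx_sub.
congr (_ + _); rewrite -(@vint_mulmx _ _ tau)//; first last.
- exact: Linfty_expmx_sub.
- exact: le_trans ttau.
by apply: eq_vint => r _; rewrite mulmxA -expmxD addrA subrK.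
Qed.

Lemma forced0 : forced 0 = 0.
Proof. exact: vint_xx. Qed.

(** A bounded curve that evolves by the Duhamel formula from any time s on is
    Lipschitz, because e^{(t-s)A} - 1 is O(t-s). *)
Lemma response_lipschitz y :
  (exists C, forall t, t \in `[0, tau] -> enorm (y t) <= C) ->
  (forall s t, 0 <= s -> s <= t -> t <= tau ->
    y t = E (t - s) *m y s + vint s t (fun r => E (t - r) *m h r)) ->
  lipschitz_curve y.
Proof.
move=> [Cy yC] yE; have [K K0 EK] := expmx_estimates A (ltW tau_gt0).
have [C C0 stepC] := step_le.
exists (K * `|Cy| + C); first by rewrite addr_ge0// mulr_ge0.
move=> s t s0 st ttau; have [vC _ _] := stepC s t s0 st ttau.
rewrite (yE s t)// addrAC -{2}[y s]mul1mx -mulmxBl.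
rewrite (le_trans (ler_enormD _ _))// mulrDl lerD//.
have ts0 : t - s \in `[0, tau] by rewrite in_itv/=; lra.
have [_ /le_trans + _] := EK _ (y s) ts0; apply.
rewrite mulrAC; apply: ler_wpM2r; first by lra.
apply: ler_wpM2l => //; apply: le_trans (ler_norm Cy); apply: yC.
by rewrite in_itv/=; lra.
Qed.

Lemma forced_lipschitz : lipschitz_curve forced.
Proof.
apply: response_lipschitz => [|s t]; last exact: forced_shift.
have [C C0 stepC] := step_le; exists (C * tau) => t.
rewrite in_itv/= => /andP[t0 ttau]; have [vC _ _] := stepC 0 t (lexx 0) t0 ttau.
by apply: le_trans vC _; apply: ler_wpM2l => //; lra.
Qed.

(** One step of the Duhamel formula and one step of the integral equation differ
    by (e^{(t-s)A} - 1 - (t-s)A) y(s), minus the integral of A (y(r) - y(s)),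
    plus the integral of (e^{(t-r)A} - 1) h(r). Each of these three terms is
    quadratic in t - s, the second one because y is Lipschitz. *)
Lemma step_gap y : lipschitz_curve y -> exists2 C, 0 <= C &
  forall s t, 0 <= s -> s <= t -> t <= tau ->
  enorm ((E (t - s) *m y s + vint s t (fun r => E (t - r) *m h r))
    - (y s + vint s t (fun r => A *m y r + h r))) <= C * (t - s) ^+ 2.
Proof.
move=> yLip; have yX := lipschitz_curve_CX yLip; have [Ly Ly0 yLy] := yLip.
have [K K0 EK] := expmx_estimates A (ltW tau_gt0).
have [C C0 stepC] := step_le; have [Cy yC] := CX_bounded tau_gt0 yX.
have CA0 := mxnorm2_ge0 A; set CA := mxnorm2 A in CA0.
exists (K * `|Cy| + CA * Ly + C); first by rewrite !addr_ge0 ?mulr_ge0.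
move=> s t s0 st ttau; have [_ hC _] := stepC s t s0 st ttau.
have yL := CX_Linfty tau_gt0 yX.
have cstM (M : 'M[R]_n) : forall i j, continuous (fun _ : R => M i j).
  by move=> i j q; exact: cvg_cst.
have AyL : in_Linfty tau (fun r => A *m y r) by exact: (Linfty_mulmx tau_gt0 (cstM A)).
have ysL : in_Linfty tau (fun r => A *m (y r - y s)).
  apply: (Linfty_mulmx tau_gt0 (cstM A)); apply: LinftyB => //.
  by apply: (@CX_Linfty _ _ _ tau_gt0 setT); exact: CX_cst.
have AcL : in_Linfty tau (fun=> A *m y s).
  by apply: (@CX_Linfty _ _ _ tau_gt0 setT); exact: CX_cst.
have -> : (E (t - s) *m y s + vint s t (fun r => E (t - r) *m h r))
    - (y s + vint s t (fun r => A *m y r + h r)) =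
  (E (t - s) - 1%:M - (t - s) *: A) *m y s
   - vint s t (fun r => A *m (y r - y s))
   + vint s t (fun r => (E (t - r) - 1%:M) *m h r).
  have -> : vint s t (fun r => (E (t - r) - 1%:M) *m h r) =
      vint s t (fun r => E (t - r) *m h r) - vint s t h.
    rewrite -(@vintB _ _ tau)//; last exact: Linfty_expmx_sub.
    by apply: eq_vint => r _; rewrite mulmxBl mul1mx.
  have -> : vint s t (fun r => A *m (y r - y s)) =
      vint s t (fun r => A *m y r) - (t - s) *: (A *m y s).
    rewrite -vint_cst// -(@vintB _ _ tau)//.
    by apply: eq_vint => r _; rewrite mulmxBr.
  rewrite (@vintD _ _ tau)// !mulmxBl mul1mx -scalemxAl.
  apply/matrixP => i j; rewrite !mxE.
  set a1 := \sum_(_ < n) _; set a2 := \sum_(_ < n) _; ring.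
rewrite (le_trans (ler_enormD _ _))// 2!mulrDl lerD//.
rewrite (le_trans (ler_enormB _ _))// lerD//.
  have ts0 : t - s \in `[0, tau] by rewrite in_itv/=; lra.
  have [_ _ /le_trans] := EK _ (y s) ts0; apply.
  rewrite mulrAC; apply: ler_wpM2r; first exact: sqr_ge0.
  apply: ler_wpM2l => //; apply: le_trans (ler_norm Cy); apply: yC.
  by rewrite in_itv/=; lra.
rewrite expr2 mulrA; apply: (@enorm_vint_le_cst _ _ tau) => //.
  by rewrite !mulr_ge0//; lra.
apply: aeW => r; rewrite in_itv/= => /andP[sr rt].
rewrite (le_trans (enorm_mulmx _ _))// -mulrA ler_wpM2l//.
by rewrite (le_trans (yLy s r _ _ _))//; last apply: ler_wpM2l; lra.
Qed.

(** The increments of y(t) - int_0^t (A y + h) are the gaps of [step_gap], so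
    this curve is constant. *)
Lemma duhamel_solution y :
  (forall t, t \in `[0, tau] -> y t = E t *m y 0 + forced t) ->
  forall t, t \in `[0, tau] -> y t = y 0 + vint 0 t (fun r => A *m y r + h r).
Proof.
move=> yE.
have itvP s t : 0 <= s -> s <= t -> t <= tau ->
    s \in `[0, tau] /\ t \in `[0, tau] by rewrite !in_itv/=; lra.
have yshift s t : 0 <= s -> s <= t -> t <= tau ->
    y t = E (t - s) *m y s + vint s t (fun r => E (t - r) *m h r).
  move=> s0 st ttau; have [sI tI] := itvP s t s0 st ttau.
  rewrite (yE t)// (yE s)// (@forced_shift s t)// mulmxDr mulmxA -expmxD subrK.
  by rewrite addrA.
have [K K0 EK] := expmx_estimates A (ltW tau_gt0).
have [Cf fC] := CX_bounded tau_gt0 (lipschitz_curve_CX forced_lipschitz).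
have yLip : lipschitz_curve y.
  apply: response_lipschitz yshift; exists (K * enorm (y 0) + Cf) => t tI.
  rewrite yE// (le_trans (ler_enormD _ _))// lerD ?fC//.
  by have [] := EK t (y 0) tI.
have [C C0 gapC] := step_gap yLip.
have fL : in_Linfty tau (fun r => A *m y r + h r).
  apply: LinftyD => //; apply: Linfty_mulmx => //.
    by move=> i j q; exact: cvg_cst.
  by apply: CX_Linfty => //; exact: lipschitz_curve_CX yLip.
move=> t tI; apply/eqP; rewrite -subr_eq; apply/eqP.
pose phi t := y t - vint 0 t (fun r => A *m y r + h r).
rewrite -[LHS]/(phi t) (eq_of_quadratic_increments C0 (y := phi))//.
  by rewrite /phi vint_xx subr0.
move=> s {tI}t s0 st ttau; apply: le_trans (gapC s t s0 st ttau).
rewrite -(yshift s t)// /phi (@vint_split _ _ tau _ s t)//.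
move: (vint 0 s _) (vint s t _) => v w.
suff -> : y t - (v + w) - (y s - v) = y t - (y s + w) by [].
by apply/matrixP => i j; rewrite !mxE; ring.
Qed.

Lemma integral_lipschitz (f : R -> 'cV[R]_n) : in_Linfty tau f ->
  lipschitz_curve (fun t => vint 0 t f).
Proof.
move=> fL; have [_ [C fC]] := fL; exists `|C| => // s t s0 st ttau.
have FF := ae_lebesgue_filter (R := R).
rewrite (@vint_split _ _ tau _ s t)// addrC addKr.
apply: (@enorm_vint_le_cst _ _ tau) => //.
apply: filterS fC => r fr; rewrite in_itv/= => /andP[sr rt].
by rewrite (le_trans (fr _)) ?ler_norm// in_itv/=; lra.
Qed.

(** The gap now bounds d(t) - e^{(t-s)A} d(s), where d is y minus the forced
    response; multiplying by e^{-tA} makes it an increment of e^{-tA} d(t). *)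
Lemma solution_duhamel y : CX tau setT y ->
  (forall t, t \in `[0, tau] -> y t = y 0 + vint 0 t (fun r => A *m y r + h r)) ->
  forall t, t \in `[0, tau] -> y t = E t *m y 0 + forced t.
Proof.
move=> yX yE.
have itvP s t : 0 <= s -> s <= t -> t <= tau ->
    s \in `[0, tau] /\ t \in `[0, tau] by rewrite !in_itv/=; lra.
have fL : in_Linfty tau (fun r => A *m y r + h r).
  apply: LinftyD => //; apply: Linfty_mulmx => //.
    by move=> i j q; exact: cvg_cst.
  exact: CX_Linfty yX.
have yshift s t : 0 <= s -> s <= t -> t <= tau ->
    y t = y s + vint s t (fun r => A *m y r + h r).
  move=> s0 st ttau; have [sI tI] := itvP s t s0 st ttau.
  by rewrite (yE t)// (yE s)// (@vint_split _ _ tau _ s t)// addrA.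
have yLip : lipschitz_curve y.
  have [Ly Ly0 yLy] := integral_lipschitz fL; exists Ly => // s t s0 st ttau.
  have [sI tI] := itvP s t s0 st ttau.
  by rewrite (yE t)// (yE s)// opprD addrACA subrr add0r yLy.
have [C C0 gapC] := step_gap yLip.
(* Estimates for -A bound the backward transport e^{-tA}. *)
have [K K0 EK] := expmx_estimates (- A) (ltW tau_gt0).
pose psi t := E (- t) *m (y t - forced t).
have psiE : forall t, t \in `[0, tau] -> psi t = psi 0.
  apply: (@eq_of_quadratic_increments _ (K * C)); first exact: mulr_ge0.
  move=> s t s0 st ttau; have [sI tI] := itvP s t s0 st ttau.
  have -> : psi t - psi s = expmx (t *: - A) *m
      ((y s + vint s t (fun r => A *m y r + h r)) -
       (E (t - s) *m y s + vint s t (fun r => E (t - r) *m h r))).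
    rewrite -(yshift s t)// scalerN -scaleNr /psi (@forced_shift s t)//.
    have -> : E (- s) = E (- t) *m E (t - s).
      by rewrite -expmxD addrA addNr add0r.
    rewrite -mulmxA -mulmxBr; congr (_ *m _); rewrite mulmxBr.
    have rearrange (p q v e : 'cV[R]_n) : p - (q + v) - (e - q) = p - (e + v).
      by apply/matrixP => i j; rewrite !mxE; ring.
    exact: rearrange.
  have [/le_trans + _ _] := EK t ((y s + vint s t (fun r => A *m y r + h r)) -
    (E (t - s) *m y s + vint s t (fun r => E (t - r) *m h r))) tI; apply.
  by rewrite -mulrA ler_wpM2l// enorm_distC gapC.
move=> t tI; apply/eqP; rewrite -subr_eq; apply/eqP.
have := psiE t tI; rewrite /psi forced0 subr0 oppr0 expmx0 mul1mx => <-.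
by have := expmxNK A (- t); rewrite opprK => EK1; rewrite mulmxA EK1 mul1mx.
Qed.

End FixedForcing.
End VariationOfConstants.

(** * Mean value inequality for vector fields *)
Section MeanValue.
Context {R : realType} {n : nat}.
Variable g : 'cV[R]_n -> 'cV[R]_n.
Implicit Types (v w p q xi : 'cV[R]_n).

Let coord_differentiable xi i : differentiable g xi ->
  differentiable (fun y => g y i 0) xi.
Proof.
move=> gxi; apply: (@differentiable_comp _ _ _ _ g (fun M : 'cV[R]_n => M i 0)) => //.
exact: differentiable_coord.
Qed.

Lemma derive_coord_jacobian xi v i : differentiable g xi ->
  'D_v (fun y => g y i 0) xi = (jacobian_mx g xi *m v) i 0.
Proof.
move=> /coord_differentiable gxi; rewrite deriveE//.
rewrite {1}[v]matrix_sum_delta linear_sum mxE; apply: eq_bigr => j _.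
by rewrite big_ord1 linearZ/= mxE deriveE// mulrC.
Qed.

(** The difference quotient of g along the segment is, term by term, the one
    defining the directional derivative of g. *)
Lemma is_derive_segment p v i (s : R) : differentiable g (p + s *: v) ->
  is_derive s (1 : R) (fun s => g (p + s *: v) i 0)
    ((jacobian_mx g (p + s *: v) *m v) i 0).
Proof.
move=> gs; rewrite -derive_coord_jacobian//.
have quotE : (fun h : R => h^-1 *: (g (p + (h *: (1 : R) + s) *: v) i 0 -
      g (p + s *: v) i 0)) =
    (fun h => h^-1 *: (g (h *: v + (p + s *: v)) i 0 - g (p + s *: v) i 0)).
  apply/funext => h; congr (_ *: (g _ i 0 - _)).
  by rewrite [h *: _]mulr1 scalerDl addrCA.
split.
  rewrite /derivable [X in cvg (X @ _)]quotE.
  exact: diff_derivable (coord_differentiable i gs).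
by rewrite /derive [X in lim (X @ _)]quotE.
Qed.

(** The vector mean value theorem fails, but the scalar one applies to
    s |-> <w, g(p + s v)> with w the increment of g, and Cauchy-Schwarz then
    gives |w|^2 <= |w| L |v|. *)
Lemma mean_value_le (C : set 'cV[R]_n) (L : R) : convex_set C ->
  (forall xi, C xi -> differentiable g xi) ->
  (forall xi, C xi -> mxnorm2 (jacobian_mx g xi) <= L) ->
  forall p q, C p -> C q -> enorm (g p - g q) <= L * enorm (p - q).
Proof.
move=> Ccvx gC JL q p Cq Cp; set v := q - p; set w := g q - g p.
have segC (s : R) : s \in `[0, 1] -> C (p + s *: v).
  rewrite in_itv/= => /andP[s0 s1].
  have := Ccvx q p (Itv01 s0 s1) (mem_set Cq) (mem_set Cp); rewrite inE.
  congr C; apply/matrixP => i j; rewrite /conv/= !mxE /unstable.onem; ring.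
pose f s := edot w (g (p + s *: v)).
have fd (s : R) : s \in `[0, 1] ->
    is_derive s (1 : R) f (edot w (jacobian_mx g (p + s *: v) *m v)).
  move=> sI.
  rewrite (_ : f = \sum_i (w i 0 \*: (fun s => g (p + s *: v) i 0))); last first.
    by apply/funext => r; rewrite fct_sumE.
  apply: is_derive_sum => i; apply: is_deriveZ; apply: is_derive_segment.
  exact/gC/segC.
have fc : {within `[0, 1], continuous f}.
  apply: derivable_within_continuous => s sI.
  by have [] := fd s sI.
have [c cI] := MVT_segment ler01 (fun s sI => fd s (subset_itv_oo_cc sI)) fc.
have pv : p + v = q by rewrite addrC subrK.
rewrite /f scale1r scale0r addr0 subr0 mulr1 pv => fE.
have [w0|w0] := eqVneq (enorm w) 0.
  by rewrite w0 mulr_ge0 ?enorm_ge0// (le_trans (mxnorm2_ge0 _) (JL q Cq)).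
have w_gt0 : 0 < enorm w by rewrite lt_neqAle eq_sym w0 enorm_ge0.
rewrite -(ler_pM2l w_gt0) -expr2 enorm_sqr {2}/w edotDr edotNr fE.
rewrite (le_trans (edot_le _ _))// ler_pM2l//.
exact/enorm_mulmx_le/JL/segC.
Qed.
End MeanValue.

(** * Geometric convergence *)
Section GeometricConvergence.
Context {R : realType} {n : nat}.
Implicit Types (a : nat -> 'cV[R]_n) (q d e : R).

Lemma geometric_small q d e : 0 <= q -> q < 1 -> 0 < e ->
  exists k, d * q ^+ k < e.
Proof.
move=> q0 q1 e0; have : d * q ^+ k @[k --> \oo] --> d * 0.
  by apply: cvgMr; apply: cvg_expr; rewrite ger0_norm.
rewrite mulr0 => /cvgr_lt /(_ e e0)[N _ Ne]; exists N.
by apply: Ne => /=.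
Qed.

Lemma le0_of_geometric_bound q d e : 0 <= q -> q < 1 ->
  (forall k, e <= d * q ^+ k) -> e <= 0.
Proof.
move=> q0 q1 eq; rewrite leNgt; apply/negP => e0.
by have [k] := geometric_small d q0 q1 e0; rewrite ltNge eq.
Qed.

(** The rate of convergence is explicit, so that it is uniform over a family of
    sequences with the same q and d. *)
Lemma geometric_cvg a q d : 0 <= q -> q < 1 ->
  (forall k, enorm (a k.+1 - a k) <= d * q ^+ k) ->
  exists l, forall k, enorm (a k - l) <= d / (1 - q) * q ^+ k.
Proof.
move=> q0 q1 aq.
have d0 : 0 <= d.
  by have := le_trans (enorm_ge0 _) (aq 0%N); rewrite expr0 mulr1.
have q1' : 0 < 1 - q by rewrite subr_gt0.
(* The right-hand side is the sum of the d q^j for k <= j < k + m. *)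
have tail k m : enorm (a k - a (k + m)%N) <=
    d / (1 - q) * q ^+ k - d / (1 - q) * q ^+ (k + m).
  elim: m => [|m IH]; first by rewrite addn0 !subrr enorm0.
  rewrite addnS -(subrK (a (k + m)%N) (a k)) -addrA.
  rewrite (le_trans (ler_enormD _ _))//.
  have -> : d / (1 - q) * q ^+ k - d / (1 - q) * q ^+ (k + m).+1 =
      (d / (1 - q) * q ^+ k - d / (1 - q) * q ^+ (k + m)) + d * q ^+ (k + m).
    by rewrite exprS; field; lra.
  by rewrite lerD// enorm_distC.
have cvga i : cvgn (fun k => a k i 0).
  pose z k := a k.+1 i 0 - a k i 0.
  have -> : (fun k => a k i 0) = fun k => series z k + a 0%N i 0.
    apply/funext => k; rewrite /series /z /=.
    by rewrite (telescope_sumr (fun k => a k i 0))// subrK.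
  apply: is_cvgD; last exact: is_cvg_cst.
  apply: normed_cvg; apply: (@series_le_cvg _ _ (geometric d q)).
  - by move=> k /=.
  - by move=> k; rewrite /geometric /= mulr_ge0// exprn_ge0.
  - move=> k; rewrite /geometric /= (le_trans _ (aq k))//.
    by apply: le_trans (coord_le_enorm _ i); rewrite !mxE.
  - by apply: is_cvg_geometric_series; rewrite ger0_norm.
pose l : 'cV[R]_n := \col_i limn (fun k => a k i 0).
have al : a k @[k --> \oo] --> l.
  by apply: cvg_mx_entries => i j; rewrite ord1 mxE; exact: cvga.
exists l => k; apply/ler_addgt0Pl => e e0.
have [N _ Ne] := al _ (near_enorm l e0).
have := Ne (k + N)%N (leq_addl _ _) => /= le.
rewrite -(subrK (a (k + N)%N) (a k)) -addrA (le_trans (ler_enormD _ _))//.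
rewrite [leRHS]addrC lerD//; last by rewrite enorm_distC ltW.
by rewrite (le_trans (tail k N))// gerBl !mulr_ge0 ?exprn_ge0 ?invr_ge0// ltW.
Qed.

End GeometricConvergence.

(** * The integral of the exponential kernel *)
Section ExponentialKernel.
Context {R : realType}.
Variables (omega t : R).
Hypotheses (omega_gt0 : 0 < omega) (t_ge0 : 0 <= t).
Local Notation mu := (@lebesgue_measure R).

Let is_derive_kernel (s : R) : is_derive s (1 : R)
  (fun s => - (expR (omega * (t - s)) / omega)) (expR (omega * (t - s))).
Proof.
have Di : is_derive s (1 : R) (omega \*: (cst t - id)) (omega *: (0 - 1)).
  by apply: is_deriveZ; apply: is_deriveB.
have := is_deriveZ (- omega^-1) (is_derive1_comp (is_derive_expR _) Di).
rewrite (_ : _ \*: _ = fun s => - (expR (omega * (t - s)) / omega)); last first.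
  apply/funext => r; transitivity (- omega^-1 * expR (omega * (t - r))) => //.
  by rewrite mulNr mulrC.
move=> /is_derive_eq; apply.
transitivity (- omega^-1 * (expR (omega * (t - s)) * (omega * (0 - 1)))) => //.
by field; rewrite gt_eqF.
Qed.

Let continuous_kernel : continuous (fun s => expR (omega * (t - s))).
Proof.
move=> s; apply: (@continuous_comp _ _ _ (fun s => omega * (t - s)) expR).
  by apply: cvgMr; apply: cvgB; [exact: cvg_cst|exact: cvg_id].
exact: continuous_expR.
Qed.

Lemma integrable_exp_kernel :
  mu.-integrable `[0, t] (EFin \o (fun s => expR (omega * (t - s)))).
Proof.
apply: continuous_compact_integrable; first exact: segment_compact.
exact: continuous_subspaceT.
Qed.

Lemma Rintegral_exp_kernel :
  \int[mu]_(s in `[0, t]) expR (omega * (t - s)) = (expR (omega * t) - 1) / omega.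
Proof.
have [->|t_neq0] := eqVneq t 0.
  by rewrite set_itv1 Rintegral_set1 mulr0 expR0 subrr mul0r.
have t_gt0 : 0 < t by rewrite lt_neqAle eq_sym t_neq0.
pose F s := - (expR (omega * (t - s)) / omega).
have Fc : continuous F.
  move=> s; apply: differentiable_continuous; apply/derivable1_diffP.
  by have [] := is_derive_kernel s.
rewrite /Rintegral (@continuous_FTC2 _ _ F)//.
- by rewrite /F /= subrr subr0 mulr0 expR0; field; rewrite gt_eqF.
- exact: continuous_subspaceT.
- split; first by move=> s _; have [] := is_derive_kernel s.
    by apply: cvg_at_right_filter; exact: Fc.
  by apply: cvg_at_left_filter; exact: Fc.
- by move=> s _; rewrite derive1E; apply: derive_val.
Qed.

End ExponentialKernel.

(** * The boundary value problem *)
Section BoundaryValueProblem.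
Context {R : realType} {n : nat}.
Variables (tau : R) (D : set 'cV[R]_n) (A : 'M[R]_n).
Variables (g : 'cV[R]_n -> 'cV[R]_n) (u : R -> 'cV[R]_n).
Variables (B : (R -> 'cV[R]_n) -> 'cV[R]_n) (beta : 'cV[R]_n).
Hypothesis tau_gt0 : 0 < tau.
Hypothesis g_diff : forall xi, D xi -> differentiable g xi.
Hypothesis u_Linfty : in_Linfty tau u.
Hypothesis B_bl : bounded_linear_functional tau B.
Hypothesis Btau_nonsing : \det (Btau A B) != 0.
Implicit Types (x y : R -> 'cV[R]_n) (C : set 'cV[R]_n).
Local Notation E t := (expmx (t *: A)).
Local Notation F := (picard_op A g u B beta).
Local Notation c := (picard_const A g u B beta).

Let h x s := g (x s) + u s.

Lemma CX_comp C x : C `<=` D -> CX tau C x -> CX tau setT (fun s => g (x s)).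
Proof.
move=> CD [xc xC]; split=> //; apply/subspace_continuousP => s s0.
move/subspace_continuousP : xc => /(_ s s0) xs.
have gc : {for x s, continuous g}.
  by apply: differentiable_continuous; exact/g_diff/CD/xC.
exact: (cvg_comp x g xs gc).
Qed.

Lemma Linfty_rhs C x : C `<=` D -> CX tau C x -> in_Linfty tau (h x).
Proof.
by move=> CD xX; apply: LinftyD => //; apply: CX_Linfty => //; exact: CX_comp xX.
Qed.

Lemma CX_duhamel C x : C `<=` D -> CX tau C x -> CX tau setT (duhamel A g u x).
Proof.
move=> CD xX; apply: lipschitz_curve_CX => //.
by apply: forced_lipschitz => //; exact: Linfty_rhs xX.
Qed.

Lemma duhamel0 x : duhamel A g u x 0 = 0.
Proof. exact: forced0. Qed.

Lemma CX_expmx v : CX tau setT (fun t => E t *m v).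
Proof.
split=> //; apply/within_continuous_coordP => i.
apply: continuous_subspaceT => t.
rewrite (_ : (fun t => _) = fun t => \sum_j E t i j * v j 0); last first.
  by apply/funext => s; rewrite mxE.
rewrite /continuous_at; apply: cvg_big => [|j _]; first exact: add_continuous.
by apply: cvgMl; exact: continuous_expmx.
Qed.

Lemma functional_expmx v : B (fun t => E t *m v) = Btau A B *m v.
Proof.
have -> : (fun t => E t *m v) =
    fun t => \sum_(j < n) v j 0 *: (E t *m delta_mx j 0).
  apply/funext => t; rewrite {1}[v]matrix_sum_delta mulmx_sumr.
  by apply: eq_bigr => j _; rewrite big_ord1 -scalemxAr.
rewrite (functional_sum B_bl); last first.
  move=> j; apply: CX_eq (CX_expmx (v j 0 *: delta_mx j 0)) _ => t _.
  by rewrite scalemxAr.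
apply/matrixP => i k; rewrite ord1 summxE mxE; apply: eq_bigr => j _.
by rewrite (functionalZ B_bl _ (CX_expmx _)) !mxE mulrC.
Qed.

(** Applying B to the Duhamel formula gives B y = B_tau y(0) + B(w), with w the
    Duhamel integral of y. Hence B y = beta holds if and only if y(0) = c(y). *)
Lemma picard_fixed_iff_solution y : CX tau D y ->
  bvp_solution tau D A g u B beta y <->
  forall t, t \in `[0, tau] -> y t = F y t.
Proof.
move=> yX; have hL := Linfty_rhs (fun _ => id) yX.
have wX := CX_duhamel (fun _ => id) yX.
have zero_in : 0 \in `[0, tau] by rewrite in_itv/= lexx ltW.
have Btau_unit : Btau A B \in unitmx by rewrite unitmxE unitfE.
have reassoc t : vint 0 t (fun s => A *m y s + g (y s) + u s) =
    vint 0 t (fun s => A *m y s + h y s).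
  by congr vint; apply/funext => s; rewrite addrA.
split=> [[_ yE By]|yF].
  have yD : forall t, t \in `[0, tau] -> y t = E t *m y 0 + duhamel A g u y t.
    apply: (solution_duhamel tau_gt0 hL (CX_setT yX)) => t tI.
    by rewrite -reassoc; exact: yE.
  have y0 : y 0 = c y.
    rewrite /picard_const -mulmxBr; apply: (canRL (mulKmx Btau_unit)).
    rewrite -By (functional_eq tau_gt0 B_bl yX yD).
    by rewrite (functionalD B_bl (CX_expmx _) wX) functional_expmx addrK.
  by move=> t tI; rewrite /picard_op -y0; exact: yD.
have y0 : y 0 = c y.
  by rewrite yF// /picard_op duhamel0 addr0 expmx0 mul1mx.
split=> //.
  move=> t tI; rewrite reassoc.
  apply: (duhamel_solution tau_gt0 hL) tI => {}t tI.
  by rewrite y0; exact: yF.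
rewrite (functional_eq tau_gt0 B_bl yX yF).
rewrite (functionalD B_bl (CX_expmx _) wX) functional_expmx.
by rewrite /picard_const mulmxBr !mulmxA mulmxV// !mul1mx subrK.
Qed.

Variables (L M omega : R).
Hypotheses (L_ge0 : 0 <= L) (M_ge1 : 1 <= M) (omega_gt0 : 0 < omega).
Hypothesis jac_le : forall xi, D xi -> mxnorm2 (jacobian_mx g xi) <= L.
Hypothesis exp_le : forall t, t \in `[- tau, tau] ->
  mxnorm2 (E t) <= M * expR (omega * `|t|).

Let kappa := L * M * (expR (omega * tau) - 1) / omega.

Let q := L * M * (expR (omega * tau) - 1)
  * (1 + M * mxnorm2 (invmx (Btau A B)) * expR (omega * tau) * opnorm0 tau B)
  / omega.

Let M_ge0 : 0 <= M. Proof. exact: le_trans ler01 M_ge1. Qed.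

Let kappa_ge0 : 0 <= kappa.
Proof.
rewrite /kappa divr_ge0 ?(ltW omega_gt0)// !mulr_ge0// subr_ge0.
by rewrite -expR0 ler_expR mulr_ge0// ltW.
Qed.

Lemma contraction_ge0 : 0 <= q.
Proof.
have -> : q = kappa *
    (1 + M * mxnorm2 (invmx (Btau A B)) * expR (omega * tau) * opnorm0 tau B).
  by rewrite /q /kappa; ring.
rewrite mulr_ge0// addr_ge0// !mulr_ge0 ?expR_ge0 ?mxnorm2_ge0//.
exact: opnorm0_ge0.
Qed.

Lemma enorm_expmx_mul t v : t \in `[0, tau] ->
  enorm (E t *m v) <= M * expR (omega * t) * enorm v.
Proof.
rewrite in_itv/= => /andP[t0 ttau]; apply: enorm_mulmx_le.
rewrite -{2}(ger0_norm t0); apply: exp_le; rewrite in_itv/= ttau andbT.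
by rewrite (le_trans _ t0)// oppr_le0 ltW.
Qed.

(** Existence takes place in D', uniqueness possibly in D itself: the estimates
    hold in any convex part C of D. *)
Section OnConvexSubset.
Variable C : set 'cV[R]_n.
Hypotheses (C_sub : C `<=` D) (C_convex : convex_set C).

(** The control u cancels in the difference, which leaves the Lipschitz bound on
    g and the growth of the exponential. *)
Lemma duhamel_contraction x y (d : R) : CX tau C x -> CX tau C y ->
  (forall s, s \in `[0, tau] -> enorm (x s - y s) <= d) ->
  forall t, t \in `[0, tau] ->
    enorm (duhamel A g u x t - duhamel A g u y t) <= kappa * d.
Proof.
move=> xX yX xyd t; rewrite in_itv/= => /andP[t0 ttau].
have d0 : 0 <= d.
  by apply: le_trans (xyd 0 _); rewrite ?enorm_ge0// in_itv/= lexx ltW.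
have EhL z : CX tau C z -> in_Linfty tau (fun s => E (t - s) *m h z s).
  by move=> zX; apply: Linfty_expmx_sub => //; exact: Linfty_rhs zX.
have -> : duhamel A g u x t - duhamel A g u y t =
    vint 0 t (fun s => E (t - s) *m h x s - E (t - s) *m h y s).
  by rewrite (vintB tau_gt0 (lexx 0) t0 ttau (EhL x xX) (EhL y yX)).
pose k s := M * (L * d) * expR (omega * (t - s)).
have kI := integrable_exp_kernel omega t.
have kI' : (@lebesgue_measure R).-integrable `[0, t] (EFin \o k).
  exact: (integrableZl _ _ kI).
apply: (@le_trans _ _ (\int[@lebesgue_measure R]_(s in `[0, t]) k s)).
  apply: (@enorm_vint_le _ _ tau) => //.
  - by apply: LinftyB => //; exact: EhL.
  - by move=> s _; rewrite !mulr_ge0// expR_ge0.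
  apply: aeW => s sI.
  have sT : s \in `[0, tau] by move: sI; rewrite !in_itv/=; lra.
  have tsT : t - s \in `[0, tau] by move: sI; rewrite !in_itv/=; lra.
  rewrite -mulmxBr /h opprD addrACA subrr addr0.
  apply: le_trans (enorm_expmx_mul _ tsT) _.
  rewrite /k [leRHS]mulrAC; apply: ler_wpM2l; first by rewrite mulr_ge0// expR_ge0.
  have [_ xC] := xX; have [_ yC] := yX.
  have gle := mean_value_le C_convex (fun xi Cxi => g_diff (C_sub Cxi))
    (fun xi Cxi => jac_le (C_sub Cxi)).
  apply: le_trans (gle _ _ (xC s sT) (yC s sT)) _.
  by rewrite ler_wpM2l// xyd.
rewrite RintegralZl// Rintegral_exp_kernel//.
have -> : M * (L * d) * ((expR (omega * t) - 1) / omega) =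
    (L * M * d / omega) * (expR (omega * t) - 1) by ring.
have -> : kappa * d = (L * M * d / omega) * (expR (omega * tau) - 1).
  by rewrite /kappa; ring.
rewrite ler_wpM2l//; first by rewrite divr_ge0 ?mulr_ge0// ltW.
by rewrite lerD2r ler_expR ler_pM2l.
Qed.

Lemma picard_contraction x y (d : R) : CX tau C x -> CX tau C y ->
  (forall s, s \in `[0, tau] -> enorm (x s - y s) <= d) ->
  forall t, t \in `[0, tau] -> enorm (F x t - F y t) <= q * d.
Proof.
move=> xX yX xyd t tI.
have wd := duhamel_contraction xX yX xyd.
have d0 : 0 <= d.
  by apply: le_trans (xyd 0 _); rewrite ?enorm_ge0// in_itv/= lexx ltW.
have wxX := CX_duhamel C_sub xX; have wyX := CX_duhamel C_sub yX.
have cd : enorm (c x - c y) <=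
    mxnorm2 (invmx (Btau A B)) * (opnorm0 tau B * (kappa * d)).
  have -> : c x - c y = - (invmx (Btau A B) *m
      B (fun t => duhamel A g u x t - duhamel A g u y t)).
    rewrite (functionalB B_bl wxX wyX) mulmxBr /picard_const.
    by apply/matrixP => i j; rewrite !mxE; ring.
  rewrite enormN (le_trans (enorm_mulmx _ _))// ler_wpM2l ?mxnorm2_ge0//.
  apply: (enorm_functional_le tau_gt0 B_bl (CX_B wxX wyX)) => //.
  by rewrite !duhamel0 subrr.
have -> : F x t - F y t = E t *m (c x - c y) +
    (duhamel A g u x t - duhamel A g u y t).
  by rewrite mulmxBr /picard_op opprD addrACA.
rewrite (le_trans (ler_enormD _ _))//.
have -> : q * d = M * expR (omega * tau) *
    (mxnorm2 (invmx (Btau A B)) * (opnorm0 tau B * (kappa * d))) + kappa * d.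
  by rewrite /q /kappa; ring.
rewrite lerD ?wd// (le_trans (enorm_expmx_mul _ tI))//.
move: tI; rewrite in_itv/= => /andP[t0 ttau].
rewrite ler_pM ?mulr_ge0 ?expR_ge0 ?enorm_ge0// ler_wpM2l//.
by rewrite ler_expR ler_pM2l.
Qed.

Hypothesis q_lt1 : q < 1.

Lemma picard_fixed_unique x y : CX tau C x -> CX tau C y ->
  (forall t, t \in `[0, tau] -> x t = F x t) ->
  (forall t, t \in `[0, tau] -> y t = F y t) ->
  forall t, t \in `[0, tau] -> x t = y t.
Proof.
move=> xX yX xF yF t tI; have xyX := CX_B xX yX.
(* The distance in sup norm is at most q times itself, hence zero. *)
have le_sup s : s \in `[0, tau] ->
    enorm (x s - y s) <= supnorm tau (fun s => x s - y s).
  exact: (enorm_le_supnorm tau_gt0 xyX).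
have sup_le : supnorm tau (fun s => x s - y s) <=
    q * supnorm tau (fun s => x s - y s).
  apply: (supnorm_le tau_gt0) => s sI; rewrite xF// yF//.
  exact: picard_contraction xX yX le_sup s sI.
have sup0 := supnorm_ge0 tau_gt0 xyX.
apply/eqP; rewrite -subr_eq0; apply/eqP/enorm0_eq0/eqP.
rewrite eq_le enorm_ge0 andbT (le_trans (le_sup t tI))//.
have := q_lt1; rewrite -subr_gt0 => q1.
by rewrite -(pmulr_rle0 _ q1) mulrBl mul1r subr_le0.
Qed.

Hypotheses (C_nonempty : C !=set0) (C_closed : closed C).
Hypothesis F_stable : forall x, CX tau C x -> CX tau C (F x).

Lemma CX_iter_picard x k : CX tau C x -> CX tau C (iter k F x).
Proof. by move=> xX; elim: k => //= k IH; exact: F_stable. Qed.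

Lemma iter_picard_dist x y : CX tau C x -> CX tau C y ->
  exists d, forall k t, t \in `[0, tau] ->
    enorm (iter k F x t - iter k F y t) <= d * q ^+ k.
Proof.
move=> xX yX; have [d xyd] := CX_bounded tau_gt0 (CX_B xX yX).
exists d; elim=> [|k IH] t tI; first by rewrite expr0 mulr1 xyd.
rewrite /= exprS mulrCA.
exact: (picard_contraction (CX_iter_picard k xX) (CX_iter_picard k yX) IH).
Qed.

Lemma iter_picard_uniform_limit x0 : CX tau C x0 ->
  exists x d, forall k t, t \in `[0, tau] ->
    enorm (iter k F x0 t - x t) <= d * q ^+ k.
Proof.
move=> xX; have [d xd] := iter_picard_dist (F_stable xX) xX.
have q0 := contraction_ge0.
have /choice[x xlim] : forall t, exists l, t \in `[0, tau] ->
    forall k, enorm (iter k F x0 t - l) <= d / (1 - q) * q ^+ k.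
  move=> t; have [tI|_] := boolP (t \in `[0, tau]); last by exists 0.
  have step k : enorm (iter k.+1 F x0 t - iter k F x0 t) <= d * q ^+ k.
    by rewrite iterSr; exact: xd.
  have [l al] := geometric_cvg (a := fun k => iter k F x0 t) q0 q_lt1 step.
  by exists l.
by exists x, (d / (1 - q)) => k t tI; exact: xlim.
Qed.

(** Continuity passes to a uniform limit by the usual argument with e / 3, and
    the values stay in C because C is closed. *)
Lemma uniform_limit_CX (a : nat -> R -> 'cV[R]_n) x d :
  (forall k, CX tau C (a k)) ->
  (forall k t, t \in `[0, tau] -> enorm (a k t - x t) <= d * q ^+ k) ->
  CX tau C x.
Proof.
move=> aX ax; have q0 := contraction_ge0; split=> [|t tI].
  apply/within_continuous_enormP => s sI e e0.
  have e3 : 0 < e / 3 by rewrite divr_gt0.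
  have [k ke] := geometric_small d q0 q_lt1 e3.
  have [/within_continuous_enormP/(_ s sI _ e3)[r r0 ar] _] := aX k.
  exists r => // t tI st; have ast := ar t tI st.
  have as_ := le_lt_trans (ax k s sI) ke; have at_ := le_lt_trans (ax k t tI) ke.
  have -> : x s - x t = - (a k s - x s) + (a k s - a k t) + (a k t - x t).
    by apply/matrixP => i j; rewrite !mxE; ring.
  rewrite (le_lt_trans (ler_enormD _ _))// (@le_lt_trans _ _
    (enorm (a k s - x s) + enorm (a k s - a k t) + enorm (a k t - x t)))//; last lra.
  by rewrite lerD2r (le_trans (ler_enormD _ _))// enormN.
apply: C_closed => W /nbhs_normP[e /= e0 eW].
have [k ke] := geometric_small d q0 q_lt1 e0.
exists (a k t); split; first by have [_] := aX k; exact.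
apply: eW; rewrite /= (le_lt_trans (normr_le_enorm _))// enorm_distC.
exact: le_lt_trans (ax k t tI) ke.
Qed.

Lemma picard_fixed_exists :
  exists2 x, CX tau C x & forall t, t \in `[0, tau] -> x t = F x t.
Proof.
have q0 := contraction_ge0; have [v Cv] := C_nonempty.
have x0X := CX_cst tau Cv; have [x [d xd]] := iter_picard_uniform_limit x0X.
have xX := uniform_limit_CX (fun k => CX_iter_picard k x0X) xd.
exists x => // t tI; apply/eqP; rewrite -subr_eq0; apply/eqP/enorm0_eq0/eqP.
rewrite eq_le enorm_ge0 andbT.
(* F x and x are both within d q^{k+1} of the iterate of order k + 1. *)
apply: (@le0_of_geometric_bound _ q (2 * q * d)) => // k.
have xFk := picard_contraction (CX_iter_picard k x0X) xX (xd k) tI.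
have xk1 := xd k.+1 t tI; rewrite exprS /= in xk1.
rewrite -(subrK (iter k.+1 F (fun=> v) t) (x t)) -addrA (le_trans (ler_enormD _ _))//.
by rewrite enorm_distC; move: xFk xk1 => /=; lra.
Qed.

Lemma iter_picard_cvg x x0 : CX tau C x ->
  (forall t, t \in `[0, tau] -> x t = F x t) -> CX tau C x0 ->
  (fun k => supnorm tau (fun t => iter k F x0 t - x t)) @ \oo --> (0 : R).
Proof.
move=> xX xF x0X; have q0 := contraction_ge0.
have [d x0d] := CX_bounded tau_gt0 (CX_B x0X xX).
have kd k t : t \in `[0, tau] -> enorm (iter k F x0 t - x t) <= d * q ^+ k.
  elim: k t => [|k IH] t tI; first by rewrite expr0 mulr1 x0d.
  rewrite xF//= exprS mulrCA.
  exact: (picard_contraction (CX_iter_picard k x0X) xX IH).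
apply: (@squeeze_cvgr _ _ _ _ (fun=> 0) (fun k => d * q ^+ k)).
- apply: nearW => k; rewrite (supnorm_ge0 tau_gt0 (CX_B (CX_iter_picard k x0X) xX)).
  by apply: supnorm_le => // t; exact: kd.
- exact: cvg_cst.
- rewrite -[X in _ --> X](mulr0 d); apply: cvgMr.
  by apply: cvg_expr; rewrite ger0_norm.
Qed.

End OnConvexSubset.

End BoundaryValueProblem.

Theorem theorem2p1 (R : realType) (n : nat) (tau : R) (D : set 'cV[R]_n)
    (A : 'M[R]_n) (g : 'cV[R]_n -> 'cV[R]_n) (u : R -> 'cV[R]_n)
    (B : (R -> 'cV[R]_n) -> 'cV[R]_n) (beta : 'cV[R]_n)
    (L M omega : R) (D' : set 'cV[R]_n)
    (tau_gt0 : 0 < tau)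
    (D_domain : is_domain D) (D0 : D 0)
    (g_C1 : C1_on D g)
    (u_Linfty : in_Linfty tau u)
    (B_bounded_linear : bounded_linear_functional tau B)
    (Btau_nonsing : \det (Btau A B) != 0)
    (L_ge0 : 0 <= L) (M_ge1 : 1 <= M) (omega_gt0 : 0 < omega)
    (D'_nonempty : D' !=set0) (D'_closed : closed D')
    (D'_convex : convex_set D') (D'_sub : D' `<=` D)
    (jac_le : forall xi, D xi -> mxnorm2 (jacobian_mx g xi) <= L)
    (exp_le : forall t, t \in `[- tau, tau] ->
       mxnorm2 (expmx (t *: A)) <= M * expR (omega * `|t|))
    (F_stable : forall x, CX tau D' x ->
       CX tau D' (picard_op A g u B beta x))
    (contraction :
       L * M * (expR (omega * tau) - 1)
         * (1 + M * mxnorm2 (invmx (Btau A B)) * expR (omega * tau)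
                  * opnorm0 tau B) / omega < 1) :
  exists xstar : R -> 'cV[R]_n,
    [/\ CX tau D' xstar,
        forall x0, CX tau D' x0 ->
          (fun k : nat => supnorm tau
             (fun t => iter k (picard_op A g u B beta) x0 t - xstar t))
          @ \oo --> (0 : R),
        bvp_solution tau D A g u B beta xstar
      & forall y, bvp_solution tau D A g u B beta y ->
          CX tau D' y \/ convex_set D ->
          forall t, t \in `[0, tau] -> y t = xstar t].
Proof.
have g_diff xi : D xi -> differentiable g xi by move=> /g_C1[].
have [x xX xF] := picard_fixed_exists tau_gt0 g_diff u_Linfty B_bounded_linear
  L_ge0 M_ge1 omega_gt0 jac_le exp_le D'_sub D'_convex contraction
  D'_nonempty D'_closed F_stable.
have xXD : CX tau D x by case: xX => xc xD'; split=> // t /xD'/D'_sub.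
exists x; split => //.
- move=> x0; exact: (iter_picard_cvg tau_gt0 g_diff u_Linfty B_bounded_linear
    L_ge0 M_ge1 omega_gt0 jac_le exp_le D'_sub D'_convex contraction F_stable).
- exact/(picard_fixed_iff_solution beta tau_gt0 g_diff u_Linfty B_bounded_linear
    Btau_nonsing xXD).
move=> y ysol yC.
have yXD : CX tau D y by case: ysol.
have yF := (picard_fixed_iff_solution beta tau_gt0 g_diff u_Linfty
  B_bounded_linear Btau_nonsing yXD).1 ysol.
case: yC => [yX|D_convex].
  exact: (picard_fixed_unique tau_gt0 g_diff u_Linfty B_bounded_linear
    L_ge0 M_ge1 omega_gt0 jac_le exp_le D'_sub D'_convex contraction yX xX yF xF).
exact: (picard_fixed_unique tau_gt0 g_diff u_Linfty B_bounded_linear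
  L_ge0 M_ge1 omega_gt0 jac_le exp_le (fun _ => id) D_convex contraction
  yXD xXD yF xF).
Qed.
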